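(* Let $C\subset\mathbb{R}^{n+1}$, $n\ge1$, be an unbounded convex body with non-degenerate asymptotic cone. Then the isoperimetric profile $I_C:(0,\infty)\to[0,\infty)$ is continuous.
   Context: An unbounded convex body $C\subset\mathbb{R}^{n+1}$ is a closed unbounded convex set with non-empty interior. Its asymptotic cone is $C_\infty=\bigcap_{\lambda>0}\lambda(C-p)$, where $p\in C$ is any point (independent of $p$). It is non-degenerate if $\dim C_\infty=n+1$. $|E|$ is $(n+1)$-dimensional Lebesgue measure. $P_C(E)=\sup\{\int_E\operatorname{div}\xi\,dx\}$ over smooth vector fields $\xi$ with compact support in $\operatorname{int}(C)$ and $|\xi|\le1$. $I_C(v)=\inf\{P_C(E):E\subset C,\ |E|=v\}$. *)

(* Defs.v *)
From HB Require Import structures.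
From mathcomp Require Import all_boot all_order all_algebra.
From mathcomp Require Import all_classical all_reals all_analysis.

Set Implicit Arguments.
Unset Strict Implicit.
Unset Printing Implicit Defensive.

Import Order.TTheory GRing.Theory Num.Theory.
Import numFieldNormedType.Exports.

Local Open Scope classical_set_scope.
Local Open Scope ring_scope.

(* The sigma-algebra on row vectors is generated by the coordinates, as it is
   for n.-tuple in the library; on 'rV[R]_n it is the Borel sigma-algebra. *)
Definition rV_display : measure_display -> measure_display.
Proof. exact. Qed.

Section measurable_rV.
Context {d} {T : sigmaRingType d}.
Variable n : nat.

Let coors : 'I_n -> 'rV[T]_n -> T := fun i x => x ord0 i.

Let rV_set0 : g_sigma_preimage coors set0.
Proof. exact: sigma_algebra0. Qed.

Let rV_setC A : g_sigma_preimage coors A -> g_sigma_preimage coors (~` A).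
Proof. exact: sigma_algebraC. Qed.

Let rV_bigcup (F : _^nat) : (forall i, g_sigma_preimage coors (F i)) ->
  g_sigma_preimage coors (\bigcup_i (F i)).
Proof. exact: sigma_algebra_bigcup. Qed.

HB.instance Definition _ := @isMeasurable.Build (rV_display d)
  'rV[T]_n (g_sigma_preimage coors) rV_set0 rV_setC rV_bigcup.

End measurable_rV.

Section lebesgue_measure_rV.
Context {R : realType}.

Definition cons_rV n (x : R * 'rV[R]_n) : 'rV[R]_n.+1 :=
  row_mx (x.1)%:M x.2.

Lemma measurable_coord n (i : 'I_n) :
  measurable_fun [set: 'rV[R]_n] (fun x : 'rV[R]_n => x ord0 i).
Proof.
move=> _ Y mY; rewrite setTI; apply: sub_sigma_algebra => /=.
rewrite -bigcup_seq/=; exists i => /=; first by rewrite mem_index_enum.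
by exists Y => //; rewrite setTI.
Qed.

Lemma measurable_fun_rVP d (T : measurableType d) n (f : T -> 'rV[R]_n) :
  measurable_fun [set: T] f <->
  forall i, measurable_fun [set: T] (fun x => f x ord0 i).
Proof.
split=> [mf i|mf].
  by apply: (measurableT_comp (@measurable_coord n i)).
have : g_sigma_preimage (fun i => (fun x : 'rV[R]_n => x ord0 i) \o f)
    `<=` measurable.
  apply: smallest_sub; first exact: sigma_algebra_measurable.
  case: n => [|n] in f mf *; first by rewrite big_ord0.
  rewrite -bigcup_mkord_ord; apply: bigcup_sub => i Ii.
  by move=> A [B mB <-]; exact: mf.
rewrite g_sigma_preimage_comp => prefS _ A mA.
by apply: prefS; exists A.
Qed.

Lemma cons_rV0 n (x : R * 'rV[R]_n) : cons_rV x ord0 ord0 = x.1.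
Proof.
transitivity ((cons_rV x : 'rV[R]_(1 + n)) ord0 (lshift n ord0)).
  by congr (fun_of_matrix _ _ _); exact/val_inj.
by rewrite /cons_rV row_mxEl mxE.
Qed.

Lemma cons_rVS n (x : R * 'rV[R]_n) (j : 'I_n) :
  cons_rV x ord0 (lift ord0 j) = x.2 ord0 j.
Proof.
transitivity ((cons_rV x : 'rV[R]_(1 + n)) ord0 (rshift 1 j)).
  by congr (fun_of_matrix _ _ _); exact/val_inj.
by rewrite /cons_rV row_mxEr.
Qed.

Lemma measurable_cons_rV n : measurable_fun setT (@cons_rV n).
Proof.
apply/measurable_fun_rVP => i.
case: (unliftP ord0 i) => [j|] ->.
  rewrite (_ : (fun _ => _) = (fun x : 'rV[R]_n => x ord0 j) \o snd).
    by apply: measurableT_comp => //; exact: measurable_coord.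
  by apply/funext => x; rewrite cons_rVS.
rewrite (_ : (fun _ => _) = fst); first exact: measurable_fst.
by apply/funext => x; rewrite cons_rV0.
Qed.

Definition uncons_rV n (x : 'rV[R]_n.+1) : R * 'rV[R]_n :=
  (x ord0 ord0, \row_j x ord0 (lift ord0 j)).

Lemma measurable_uncons_rV n : measurable_fun setT (@uncons_rV n).
Proof.
apply/measurable_fun_pair; first exact: measurable_coord.
apply/measurable_fun_rVP => i.
under eq_fun do rewrite mxE.
exact: measurable_coord.
Qed.

Lemma cons_rVK n : cancel (@cons_rV n) (@uncons_rV n).
Proof.
move=> [a v]; rewrite /uncons_rV cons_rV0; congr pair.
by apply/rowP => j; rewrite mxE cons_rVS.
Qed.

Section product_rV.
Local Open Scope ereal_scope.
Variables (n : nat) (m : {sigma_finite_measure set 'rV[R]_n -> \bar R}).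

Definition product_rV : set 'rV[R]_n.+1 -> \bar R :=
  pushforward (@lebesgue_measure R \x m) (@cons_rV n).

Let product_rV0 : product_rV set0 = 0.
Proof. by rewrite /product_rV /pushforward preimage_set0 measure0. Qed.

Let product_rV_ge0 A : 0 <= product_rV A.
Proof. by rewrite /product_rV /pushforward measure_ge0. Qed.

Let product_rV_semi_sigma_additive : semi_sigma_additive product_rV.
Proof.
move=> F mF tF mUF; rewrite /product_rV /pushforward preimage_bigcup.
apply: measure_semi_sigma_additive.
- by move=> k; rewrite -[X in measurable X]setTI; exact: measurable_cons_rV.
- apply/trivIsetP => /= i j _ _ ij; rewrite -preimage_setI.
  by move/trivIsetP : tF => /(_ _ _ _ _ ij) ->//; rewrite preimage_set0.
- by rewrite -preimage_bigcup -[X in measurable X]setTI;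
    exact: measurable_cons_rV.
Qed.

HB.instance Definition _ := isMeasure.Build _ _ _ product_rV
  product_rV0 product_rV_ge0 product_rV_semi_sigma_additive.

Let product_rV_sigma_finite : sigma_finite setT product_rV.
Proof.
have /sigma_finiteP[F [TF ndF Foo]] := sigma_finiteT (@lebesgue_measure R).
have /sigma_finiteP[G [TG ndG Goo]] := sigma_finiteT m.
exists (fun k => @uncons_rV n @^-1` (F k `*` G k)).
  rewrite -preimage_bigcup (_ : \bigcup_k _ = setT) ?preimage_setT//.
  apply/seteqP; split=> // -[x y] _.
  have [k _ Fkx] : (\bigcup_k F k) x by rewrite -TF.
  have [l _ Gly] : (\bigcup_k G k) y by rewrite -TG.
  exists (maxn k l) => //; split.
  - by move: x Fkx; exact/subsetPset/ndF/leq_maxl.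
  - by move: y Gly; exact/subsetPset/ndG/leq_maxr.
move=> k; have [mFk Fkoo] := Foo k; have [mGk Gkoo] := Goo k; split.
  rewrite -[X in measurable X]setTI.
  by apply: measurable_uncons_rV => //; exact: measurableX.
rewrite /product_rV /pushforward -comp_preimage.
rewrite (_ : _ \o _ = id) ?preimage_id; last exact/funext/cons_rVK.
by rewrite product_measure1E// lte_mul_pinfty// ge0_fin_numE.
Qed.

HB.instance Definition _ := Measure_isSigmaFinite.Build _ _ _ product_rV
  product_rV_sigma_finite.

End product_rV.

(* Lebesgue measure on the Borel subsets of R^n, coordinate by coordinate. *)
Fixpoint borel_lebesgue_rV n : {sigma_finite_measure set 'rV[R]_n -> \bar R} :=
  if n is n'.+1 then product_rV (borel_lebesgue_rV n') else \d_(0 : 'rV[R]_0).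

(* Caratheodory-measurable sets of the outer measure induced by the Borel
   measure, i.e. the completion of the Borel sigma-algebra. *)
Definition lebesgue_measurable n : set (set 'rV[R]_n) :=
  ((borel_lebesgue_rV n)^*)%mu.-cara.-measurable.

Definition lebesgue_rV n :=
  @completed_measure_extension _ _ R (borel_lebesgue_rV n).

End lebesgue_measure_rV.
Arguments lebesgue_rV {R} n.

Section convex_bodies.
Context {R : realType} {N : nat}.
Local Notation V := 'rV[R]_N.

Definition unbounded_convex_body (C : set V) : Prop :=
  [/\ closed C, convex_set C, ~ bounded_set C & C° !=set0].

Definition asymptotic_cone (C : set V) (p : V) : set V :=
  \bigcap_(r in [set r : R | 0 < r]) [set r *: (x - p) | x in C].

(* Dimension of the affine hull: the largest d such that S contains d + 1
   affinely independent points p, s_1, ..., s_d. *)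
Definition affine_dim (S : set V) : nat :=
  \max_(d < N.+1 | `[< exists p (s : d.-tuple V),
      [/\ S p, (forall i, S (tnth s i)) & free [seq x - p | x <- s]] >]) d.

End convex_bodies.

Section perimeter.
Context {R : realType} {N : nat}.
Local Notation V := 'rV[R]_N.

Definition base_vec (i : 'I_N) : V := delta_mx ord0 i.

Definition iter_partial (s : seq 'I_N) (xi : V -> V) : V -> V :=
  foldr (fun i f x => 'D_(base_vec i) f x) xi s.

(* C^infinity: all iterated partial derivatives exist and are continuous. *)
Definition smooth (xi : V -> V) : Prop :=
  forall s, continuous (iter_partial s xi) /\
    forall i x, derivable (iter_partial s xi) x (base_vec i).

(* The library norm on 'rV[R]_N is the sup norm. *)
Definition euclidean_norm (x : V) : R :=
  Num.sqrt (\sum_(i < N) x ord0 i ^+ 2).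

Definition divergence (xi : V -> V) (x : V) : R :=
  \sum_(i < N) 'D_(base_vec i) (fun y => xi y ord0 i) x.

Definition test_field (C : set V) : set (V -> V) :=
  [set xi | [/\ smooth xi,
                compact (closure [set x | xi x != 0]),
                closure [set x | xi x != 0] `<=` C° &
                forall x, euclidean_norm (xi x) <= 1]].

Definition perimeter (C E : set V) : \bar R :=
  ereal_sup [set \int[lebesgue_rV N]_(x in E) (divergence xi x)%:E
            | xi in test_field C]%E.

Definition isoperimetric_profile (C : set V) (v : R) : \bar R :=
  ereal_inf [set perimeter C E | E in
    [set E | [/\ lebesgue_measurable E, E `<=` C &
                 lebesgue_rV N E = v%:E]]].

End perimeter.

(* Main.v *)
(* The profile I is nondecreasing, and I (v + d) <= I v + eta for small d > 0
   uniformly in v; together these give continuity.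

   Monotonicity.  If u is in the recession cone, translating a competitor E by
   - t u and intersecting with C does not increase the perimeter, since test
   fields supported in C are carried to test fields supported in C.  When u is
   interior to the cone and C is not the whole space, the volume of
   E `&` (C + t u) decreases continuously from |E| to 0, so every smaller volume
   is reached.  When C is the whole space one scales instead.

   Growth.  Far out along u the body contains cubes of any size.  Cut E by a
   half-space and add a disjoint cube making up for the missing volume: the cube
   costs at most 2 N r^(N-1), and perimeters of disjoint sets add up.  Cutting
   at level s costs at most the liminf over j of the integral over E of the
   gradient of a smooth cutoff at s of width 1/j^2; by Tonelli and Fatou the
   average of this cost over s in [S, S + M] is at most |E| / M, so some level s
   is cheap.  The cutoff is logistic: it does not need compact support, and its
   derivatives are polynomials in it. *)

From HB Require Import structures.
Require Import Defs.
From mathcomp Require Import all_boot all_order all_algebra.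
From mathcomp Require Import all_classical all_reals all_analysis.
From mathcomp Require Import measurable_realfun.
From mathcomp Require Import ring lra.
Set Implicit Arguments.
Unset Strict Implicit.
Unset Printing Implicit Defensive.

Import Order.TTheory GRing.Theory Num.Theory.
Import numFieldNormedType.Exports.
Local Open Scope classical_set_scope.
Local Open Scope ring_scope.

(** The perimeter is a supremum over test fields, so each bound comes from turning one test field
    into another: by composition with an affine map, or by multiplication with a cutoff. No
    compactness and no minimisers enter. The obstacle to growth is that a competitor may reach
    arbitrarily far, leaving no obvious room beside it; cutting below a level of [a * x ord0 i]
    makes the added cube disjoint from it. The cube supplies [d] plus the volume cut off, itself at
    most [d], so its side is at most the N-th root of [2 d]. Its cost, a multiple of the side to the
    power [N - 1], tends to 0 because [N = n + 1] is at least 2. The resulting bound does not depend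
    on [v], which gives continuity from the left: growth is applied at points below [v].
    Non-degeneracy enters through a ball of recession directions around [u]. It provides the far
    cubes, and it makes [C] the whole space as soon as [C] contains a ray in direction [- u];
    otherwise the sets [C + t u] abandon every point. *)

Section borel.
Context {R : realType}.

(** * Borel sets and affine scaling of the Borel-Lebesgue measure *)

Lemma ball_rVE N (x : 'rV[R]_N) (r : R) : 0 < r ->
  ball x r = [set y | forall i, ball (x ord0 i) r (y ord0 i)].
Proof.
move=> r0; apply/seteqP; split => [y [_ xy] i|y xy]; first exact: xy.
by split=> // i j; rewrite ord1; exact: xy.
Qed.

Lemma rV_norm_le N (x : 'rV[R]_N) (c : R) : 0 <= c ->
  (forall i, `|x ord0 i| <= c) -> `|x| <= c.
Proof.
move=> c0 h; rewrite /Num.Def.normr/= mx_normrE.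
by apply: bigmax_le => //= -[i j] _; rewrite ord1/=; exact: h.
Qed.

Lemma rV_le_norm N (x : 'rV[R]_N) i : `|x ord0 i| <= `|x|.
Proof. by rewrite [leRHS]/Num.Def.normr/= mx_normrE (le_bigmax _ _ (ord0, i)). Qed.

Lemma measurable_rectangle N (A : 'I_N -> set R) : (forall i, measurable (A i)) ->
  measurable [set y : 'rV[R]_N | forall i, A i (y ord0 i)].
Proof.
move=> mA; rewrite (_ : [set y | _] =
  \big[setI/setT]_(i < N) ((fun y : 'rV[R]_N => y ord0 i) @^-1` A i)).
  apply: bigsetI_measurable => i _; rewrite -[X in measurable X]setTI.
  by apply: measurable_coord.
rewrite -bigcap_seq; apply/seteqP; split => [y h i _|y h i]; first exact: h.
by apply: (h i); rewrite /= mem_index_enum.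
Qed.

Lemma measurable_ball_rV N (x : 'rV[R]_N) (r : R) : 0 < r ->
  measurable (ball x r).
Proof.
by move=> r0; rewrite ball_rVE//;
  apply: (@measurable_rectangle _ (fun i => ball (x ord0 i) r)) => i;
    apply: open_measurable; exact: ball_open.
Qed.

(** The sigma-algebra comes from the coordinates, so second countability is needed: [U] is the union
    of the balls with rational centre and radius [1 / k.+1] that it contains, and sup-norm balls are
    rectangles. *)
Lemma open_measurable_rV N (U : set 'rV[R]_N) : open U -> measurable U.
Proof.
move=> oU.
pose emb (q : 'rV[rat]_N) : 'rV[R]_N := map_mx (fun z : rat => ratr z) q.
pose F (qk : 'rV[rat]_N * nat) := if `[< ball (emb qk.1) qk.2.+1%:R^-1 `<=` U >]
  then ball (emb qk.1) qk.2.+1%:R^-1 else set0.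
rewrite (_ : U = \bigcup_qk F qk).
  apply: countable_bigcupT_measurable => // qk; rewrite /F.
  by case: ifPn => // _; apply: measurable_ball_rV; rewrite invr_gt0.
apply/seteqP; split => [x Ux|x [qk _]]; last first.
  by rewrite /F; case: ifPn => // /asboolP; exact.
have /nbhs_ballP[e/= e0 eU] : nbhs x U by exact: open_nbhs_nbhs.
have [k] := @ltr_add_invr _ 0 (e / 2) (divr_gt0 e0 (ltr0Sn _ 1)).
rewrite add0r => ke.
have k0 : 0 < k.+1%:R^-1 :> R by rewrite invr_gt0.
have [q qx] : exists q
  : 'rV[rat]_N, forall i, `|ratr (q ord0 i) - x ord0 i| < k.+1%:R^-1.
  move: k0; set d := _^-1 => k0.
  have h i : exists q : rat, `|ratr q - x ord0 i| < d.
    have [|q] := @rat_in_itvoo _ (x ord0 i - d) (x ord0 i + d).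
      by lra.
    rewrite in_itv/= => /andP[h1 h2]; exists q; rewrite ltr_norml; apply/andP; lra.
  exists (\row_i sval (cid (h i))) => i; rewrite mxE; exact: (svalP (cid (h i))).
exists (q, k) => //; rewrite /F.
have xq : ball (emb q) k.+1%:R^-1 x by rewrite ball_rVE//= => i; rewrite mxE;
  exact: qx.
rewrite asboolT//= => y qy; apply: eU.
apply: (@le_ball _ _ _ (k.+1%:R^-1 + k.+1%:R^-1)).
  by rewrite -(subrK (e / 2) e) lerD//; move: ke; set d := _^-1; lra.
by apply: ball_triangle qy; apply/ball_sym.
Qed.

Lemma closed_measurable_rV N (U : set 'rV[R]_N) : closed U -> measurable U.
Proof.
move=> cU; rewrite -[U]setCK; apply: measurableC; apply: open_measurable_rV.
exact: closed_openC.
Qed.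

Lemma continuous_measurable_rV N (f : 'rV[R]_N -> R) : continuous f ->
  measurable_fun setT f.
Proof.
move=> cf; apply: (measurability _ (RGenOpens.measurableE R)).
move=> _ [_ [a [b ->]] <-]; rewrite setTI.
by apply: open_measurable_rV; move/continuousP : cf; apply; exact: interval_open.
Qed.

Local Notation mu := (@borel_lebesgue_rV R).

Lemma borel_lebesgue_rectangle N (A : 'I_N -> set R)
  : (forall i, measurable (A i)) ->
  mu N [set y | forall i, A i (y ord0 i)] = (\prod_i lebesgue_measure (A i))%E.
Proof.
elim: N A => [|N IH] A mA.
  rewrite big_ord0 /= /dirac indicE mem_set//= => -[].
  by [].
rewrite big_ord_recl -(IH (fun i => A (lift ord0 i)))// -product_measure1E//;
  last first.
  by apply: (@measurable_rectangle _ (fun i => A (lift ord0 i))) => i; exact: mA.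
  exact: mA.
rewrite /= /product_rV /pushforward; congr (product_measure1 _ _ _).
apply/seteqP; split => [[x y] h|[x y] [/= h1 h2] i].
  split=> [|i]/=; first by have := h ord0; rewrite cons_rV0.
  by have := h (lift ord0 i); rewrite cons_rVS.
by case: (unliftP ord0 i) => [j|] ->; rewrite ?cons_rVS ?cons_rV0.
Qed.

Lemma measurable_affine N (a : R) (w : 'rV[R]_N) :
  measurable_fun setT (fun x : 'rV[R]_N => a *: x + w).
Proof.
apply/measurable_fun_rVP => i; rewrite (_ : (fun _ => _) =
  (fun x : 'rV[R]_N => a * x ord0 i + w ord0 i)); last by apply/funext => x;
    rewrite !mxE.
apply: measurable_funD; last exact: measurable_cst.
by apply: measurable_funM; [exact: measurable_cst|exact: measurable_coord].
Qed.

(** By uniqueness of Lebesgue measure: the rescaled pushforward agrees with it on half-open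
    intervals. *)
Lemma lebesgue_measure_affine (a : R) (a0 : 0 < a) (w : R) (A
  : set (measurableTypeR R)) :
  measurable A ->
  (a%:E * lebesgue_measure ((fun x =>
    (a * x + w)%R) @^-1` A) = lebesgue_measure A)%E.
Proof.
move=> mA.
have mf : measurable_fun setT (fun x : measurableTypeR R => (a * x + w)%R
  : measurableTypeR R).
  apply: measurable_funD; last exact: measurable_cst.
  by apply: measurable_funM; [exact: measurable_cst|exact: measurable_id].
pose m' := mscale (NngNum (ltW a0)) (pushforward lebesgue_measure (fun x
  : measurableTypeR R => (a * x + w)%R : measurableTypeR R)).
have -> // : lebesgue_measure A = m' mf A.
apply: lebesgue_measure_unique => //= X [[x y] _ <-]/=.
rewrite /mscale/= /pushforward/= lebesgue_measure_itv/= lte_fin.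
rewrite (_ : _ @^-1` _ = `](x - w) / a, (y - w) / a]%classic); last first.
  apply/seteqP; split => z /=; rewrite !in_itv/= ltr_pdivrMr// ler_pdivlMr//;
    by rewrite ltrBlDr lerBrDr (mulrC a).
rewrite lebesgue_measure_itv/= lte_fin ltr_pM2r ?invr_gt0// ltrD2r.
case: ifPn => // xy; last by rewrite mule0.
rewrite -EFinB -EFinM; congr EFin; field; lra.
Qed.

Lemma borel_lebesgue_affine N (a : R) (a0 : 0 < a) (w : 'rV[R]_N) (A
  : set 'rV[R]_N) :
  measurable A ->
  ((a ^+ N)%:E * mu N ((fun x => a *: x + w)%R @^-1` A) = mu N A)%E.
Proof.
elim: N w A => [|N IH] w A mA.
  (* ['rV[R]_0] has a single point, so the set and its preimage coincide. *)
  rewrite expr0 mul1e; congr (mu 0 _); apply/seteqP.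
  by split=> x /=; rewrite [X in A X]thinmx0 [in X in _ -> X]thinmx0.
pose T1 := (fun x : measurableTypeR R => a * x + w ord0 ord0 : measurableTypeR R).
pose w' := \row_j w ord0 (lift ord0 j).
pose T2 := (fun x : 'rV[R]_N => a *: x + w').
have mT1 : measurable_fun setT T1.
  apply: measurable_funD; last exact: measurable_cst.
  by apply: measurable_funM; [exact: measurable_cst|exact: measurable_id].
have mT2 : measurable_fun setT T2 by exact: measurable_affine.
pose T12 := fun x : measurableTypeR R * 'rV[R]_N => (T1 x.1, T2 x.2).
have mT12 : measurable_fun setT T12.
  apply/measurable_fun_pair; first exact: measurableT_comp.
  exact: measurableT_comp.
pose m' := mscale (NngNum (ltW (exprn_gt0 N.+1 a0)))
  (pushforward (@lebesgue_measure R \x mu N)%E T12).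
have mcA : measurable ((@cons_rV R N) @^-1` A).
  by rewrite -[X in measurable X]setTI; exact: measurable_cons_rV.
(* The map acts separately on head and tail, so uniqueness of the product measure reduces the claim
   to rectangles. *)
have H : (@lebesgue_measure R \x mu N)%E (@cons_rV R N @^-1` A) = m' mT12
  (@cons_rV R N @^-1` A).
  apply: product_measure_unique => // B D mB mD.
  transitivity ((a ^+ N.+1)%:E * (@lebesgue_measure R \x mu N) (T12 @^-1` (B
    `*` D)))%E.
    by [].
  rewrite (_ : T12 @^-1` (B `*` D) = (T1 @^-1` B) `*` (T2 @^-1` D)); last first.
    by apply/seteqP; split.
  rewrite product_measure1E; last 2 first.
    by rewrite -[X in measurable X]setTI; exact: mT1.
    by rewrite -[X in measurable X]setTI; exact: mT2.
  rewrite -(IH w' D mD) exprS EFinM muleACA; congr (_ * _)%E.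
  exact: lebesgue_measure_affine.
transitivity ((@lebesgue_measure R \x mu N)%E (@cons_rV R N @^-1` A)); last by [].
rewrite H; transitivity ((a ^+ N.+1)%:E *
  (@lebesgue_measure R \x mu N) (T12 @^-1` (@cons_rV R N @^-1` A)))%E; last by [].
rewrite /= /product_rV /pushforward; congr (_ * product_measure1 _ _ _)%E.
apply/seteqP; split => -[x y] /=; rewrite /T12 /T1 /T2/=;
 (suff -> : a *: cons_rV (x, y) + w = cons_rV ((a * x + w ord0 ord0),
   (a *: y + w')) by []);
 apply/rowP => i; case: (unliftP ord0 i) => [j|] ->;
 by rewrite ?(cons_rVS, cons_rV0, mxE)/= ?(cons_rVS, cons_rV0) ?mxE.
Qed.

End borel.

(** * Affine change of variables for the completed measure *)

Section completed.
Context {R : realType} {N : nat}.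
Local Notation V := 'rV[R]_N.
Local Notation mu := (@borel_lebesgue_rV R N).
Local Notation leb := (@lebesgue_rV R N).
Local Notation carV := (caratheodory_type (mu^*)%mu).

Lemma borel_lebesgue_measurable (A : set V) : measurable A -> lebesgue_measurable A.
Proof. exact: caratheodory_measurable_mu_ext. Qed.

Lemma lebesgue_rV_borel (A : set V) : measurable A -> leb A = mu A.
Proof. exact: measurable_mu_extE. Qed.

Lemma closed_lebesgue_measurable (A : set V) : closed A -> lebesgue_measurable A.
Proof. by move/closed_measurable_rV; exact: borel_lebesgue_measurable. Qed.

Lemma continuous_lebesgue_measurable (f : V -> R) : continuous f ->
  measurable_fun (setT : set carV) f.
Proof.
move=> /continuous_measurable_rV mf _ Y mY; rewrite setTI.
by apply: borel_lebesgue_measurable; rewrite -[X in measurable X]setTI; exact: mf.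
Qed.

Lemma lebesgue_measurableE (A : set V) :
  lebesgue_measurable A = ((mu^*)%mu).-caratheodory A.
Proof. by []. Qed.

Section affine.
Variables (a : R) (w : V).
Hypothesis a0 : 0 < a.
Local Notation T := (fun x : V => a *: x + w).

Lemma affineK (x : V) : a^-1 *: (T x) + - (a^-1 *: w) = x.
Proof. by rewrite /= scalerDr scalerA mulVf ?gt_eqF// scale1r addrK. Qed.

Lemma affineVK (x : V) : T (a^-1 *: x + - (a^-1 *: w)) = x.
Proof.
by rewrite /= scalerDr scalerN !scalerA mulfV ?gt_eqF// !scale1r subrK.
Qed.
End affine.

(** A Borel cover of [X] pulls back to a Borel cover of its preimage, with total measure divided by
    [a ^+ N]. The reverse inequality will be this one for the inverse map. *)
Lemma outer_affine_le (a : R) (w : V) (X : set V) : 0 < a ->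
  ((a ^+ N)%:E * (mu^*)%mu ((fun x => a *: x + w)%R @^-1` X) <= (mu^*)%mu X)%E.
Proof.
move=> a0; apply: le_ereal_inf_tmp => _ [F [mF XF] <-].
pose T := (fun x : V => a *: x + w).
have mTF k : measurable (T @^-1` F k).
  by rewrite -[X in measurable X]setTI; exact: measurable_affine.
rewrite (eq_eseriesr (g := fun k => ((a ^+ N)%:E * mu (T @^-1` F k))%E));
  last first.
  by move=> k _; rewrite borel_lebesgue_affine.
rewrite nneseriesZl//.
rewrite lee_pmul2l//; last by rewrite lte_fin exprn_gt0.
apply: ereal_inf_lbound; exists (fun k => T @^-1` F k) => //.
by split => // x /XF[k _ Fk]; exists k.
Qed.

Lemma outer_affine (a : R) (w : V) (X : set V) : 0 < a ->
  ((a ^+ N)%:E * (mu^*)%mu ((fun x => a *: x + w)%R @^-1` X) = (mu^*)%mu X)%E.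
Proof.
move=> a0; apply/eqP; rewrite eq_le outer_affine_le//=.
have a0' : 0 < a^-1 by rewrite invr_gt0.
have := @outer_affine_le a^-1 (- (a^-1 *: w)) ((fun x => a *: x + w) @^-1` X) a0'.
rewrite (_ : _ @^-1` (_ @^-1` X) = X); last first.
  by apply/seteqP; split => x /=; rewrite affineVK.
move=> h.
apply: (@le_trans _ _ ((a ^+ N)%:E * ((a^-1 ^+ N)%:E * (mu^*)%mu X))%E).
  by rewrite muleA -EFinM -exprMn mulfV ?gt_eqF// expr1n mul1e.
by rewrite lee_pmul2l// lte_fin exprn_gt0.
Qed.

Lemma lebesgue_measurable_affine (a : R) (w : V) (A : set V) : 0 < a ->
  lebesgue_measurable A -> lebesgue_measurable ((fun x => a *: x + w)%R @^-1` A).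
Proof.
move=> a0 /[!lebesgue_measurableE] mA X; pose T := (fun x : V => a *: x + w).
(* The Caratheodory criterion is tested on an arbitrary [X]. The map being bijective, [X] is the
   preimage of [X'], where the criterion for [A] applies. *)
pose X' := (fun x : V => a^-1 *: x + - (a^-1 *: w)) @^-1` X.
have XE : X = T @^-1` X' by apply/seteqP; split => x /=; rewrite /X' /= affineK.
have := mA X'.
rewrite -(@outer_affine a w X' a0) -(@outer_affine a w (X' `&` A) a0).
rewrite -(@outer_affine a w (X' `&` ~` A) a0) -ge0_muleDr ?mu_ext_ge0//.
rewrite XE => /(congr1 (fun z => (((a ^+ N)^-1)%:E * z)%E)).
by rewrite !muleA -!EFinM mulVf ?expf_eq0 ?gt_eqF ?andbF// !mul1e.
Qed.

Lemma lebesgue_rV_affine (a : R) (w : V) (A : set V) : 0 < a ->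
  ((a ^+ N)%:E * leb ((fun x => a *: x + w)%R @^-1` A) = leb A)%E.
Proof. exact: outer_affine. Qed.

Lemma integral_affine (a : R) (w : V) (E : set V) (f : V -> R) : 0 < a ->
  lebesgue_measurable E -> measurable_fun (setT : set carV) f ->
  leb.-integrable E (EFin \o f) ->
  ((a ^+ N)%:E * \int[leb]_(x in (fun x =>
    a *: x + w)%R @^-1` E) (f (a *: x + w)%R)%:E
   = \int[leb]_(x in E) (f x)%:E)%E.
Proof.
move=> a0 mE mf intf.
pose T := (fun x : carV => (a *: (x : V) + w) : carV).
have mT : measurable_fun (setT : set carV) T.
  by move=> _ Y mY; rewrite setTI; exact: lebesgue_measurable_affine.
have aN : 0 < a ^+ N by rewrite exprn_gt0.
have key (g : V -> \bar R) : measurable_fun (E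
  : set carV) g -> (forall x, 0 <= g x)%E ->
    ((a ^+ N)%:E * \int[leb]_(x in T @^-1` E) (g (T x)) = \int[leb]_(x in E) g x)%E.
  move=> mg g0.
  rewrite -(ge0_integral_pushforward mT)//.
  rewrite -(ge0_integral_mscale _ _ (NngNum (ltW aN)))//.
  by apply: eq_measure_integral => A mA _; exact: lebesgue_rV_affine.
have mfE : measurable_fun (E : set carV) (EFin \o f).
  by apply/measurable_EFinP; exact: measurable_funS mf.
have fp := integrable_pos_fin_num mE intf.
have fn := integrable_neg_fin_num mE intf.
rewrite [RHS]integralE.
move: fp fn.
rewrite -(key (EFin \o f)^\+%E)//; last exact: measurable_funepos.
rewrite -(key (EFin \o f)^\-%E)//; last exact: measurable_funeneg.
(* Factoring [a ^+ N] out of the difference of the two parts needs the transformed parts to be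
   finite, which they inherit from integrability of [f]. *)
have posM (y : \bar R) : ((a ^+ N)%:E * y)%E \is a fin_num -> y \is a fin_num.
  by case: y => // ; rewrite ?gt0_muley ?gt0_muleNy ?lte_fin.
move=> /posM fp /posM fn.
rewrite -muleBr//; last by rewrite fin_num_adde_defr.
rewrite [X in (_ * X)%E = _]integralE.
by congr (_ * (_ - _))%E; apply: eq_integral => x _; rewrite ?funeposE ?funenegE.
Qed.

End completed.

(** * The logistic function *)

Section sigmoid.
Context {R : realType}.

(** Decreasing, with limits 1 and 0 at minus and plus infinity, as suits a cutoff that keeps a lower
    half-space. *)
Definition sigmoid (t : R) : R := (1 + expR t)^-1.

Lemma sigmoid_gt0 t : 0 < sigmoid t.
Proof. by rewrite invr_gt0 ltr_pwDl// expR_ge0. Qed.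

Lemma sigmoid_lt1 t : sigmoid t < 1.
Proof. by rewrite invf_lt1; have := expR_gt0 t; lra. Qed.

Lemma continuous_sigmoid : continuous sigmoid.
Proof.
move=> t; apply: cvgV; first by rewrite gt_eqF//; have := expR_gt0 t; lra.
by apply: cvgD; [exact: cvg_cst|exact: continuous_expR].
Qed.

Lemma sigmoid_affine_derive (b c t : R) :
  is_derive t 1 (fun t => sigmoid (b * t + c))
    (- b * (sigmoid (b * t + c) * (1 - sigmoid (b * t + c)))).
Proof.
have h0 : 1 + expR (b * t + c) != 0.
  by rewrite gt_eqF//; have := expR_gt0 (b * t + c); lra.
have d : is_derive t 1 (fun t => 1 + expR (b * t + c)) (b * expR (b * t + c)).
  rewrite (_ : (fun t => _) = cst 1 + (expR \o (b \*: id + cst c))); last first.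
    by apply/funext.
  rewrite -[X in is_derive _ _ _ X]add0r; apply: is_deriveD.
  rewrite mulrC; apply: is_derive1_comp => /=.
  by rewrite -[X in is_derive _ _ _ X]addr0 -{2}[b]mulr1; apply: is_deriveD.
apply: is_derive_eq; first exact: is_deriveV.
rewrite /sigmoid /=; move: h0; set e := expR _ => h0.
by rewrite /GRing.scale/=; field.
Qed.

End sigmoid.

(** * Smooth scalar functions and products with a logistic function *)

Section smooth.
Context {R : realType} {N : nat}.
Local Notation V := 'rV[R]_N.
Implicit Types (f g : V -> R) (xi : V -> V).

Definition iter_deriv (s : seq 'I_N) f : V -> R :=
  foldr (fun i f x => 'D_(base_vec i) f x) f s.

Definition smooth_fun f := forall s, continuous (iter_deriv s f) /\
  forall i x, derivable (iter_deriv s f) x (base_vec i).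

Lemma derivable_coordP xi x v :
  derivable xi x v <-> forall j, derivable (fun y => xi y ord0 j) x v.
Proof.
split=> [/derivable_mxP h j|h]; first exact: h.
by apply/derivable_mxP => i j; rewrite ord1.
Qed.

Lemma derive_coord xi x v j : derivable xi x v ->
  'D_v xi x ord0 j = 'D_v (fun y => xi y ord0 j) x.
Proof. by move=> h; rewrite derive_mx// mxE. Qed.

Lemma continuous_coordP (T : topologicalType) (xi : T -> V) :
  continuous xi <-> forall j, continuous (fun y => xi y ord0 j).
Proof.
split=> [c j x|h x].
  by apply: (@continuous_comp _ _ _ xi (fun M : V => M ord0 j));
    [exact: c|exact: coord_continuous].
apply/cvgrPdist_le => e e0.
have : \forall y \near x, forall j, `|xi x ord0 j - xi y ord0 j| <= e.
  by apply: filter_forall => j; move/cvgrPdist_le : (h j x) => /(_ e e0).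
by apply: filterS => y hy; apply: rV_norm_le => [|i]; [exact: ltW|rewrite !mxE].
Qed.

(** Reduces smooth fields to scalar components, to which the product rule applies. *)
Lemma smooth_coordP xi :
  smooth xi <-> forall j, smooth_fun (fun y => xi y ord0 j).
Proof.
split=> [sxi j|h].
  have E s : iter_deriv s (fun y => xi y ord0 j) = (fun y =>
    iter_partial s xi y ord0 j).
    elim: s => //= i s IH; apply/funext => x; rewrite IH derive_coord//.
    exact: (sxi s).2.
  move=> s; rewrite E; split; first by move: j {E}; apply/continuous_coordP;
    exact: (sxi s).1.
  by move=> i x; move: j {E}; apply/derivable_coordP; exact: (sxi s).2.
have E s : iter_partial s xi = (fun y => \row_j iter_deriv s (fun y =>
  xi y ord0 j) y).
  elim: s => [|i s IH]; first by apply/funext => x; apply/rowP => j; rewrite mxE.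
  apply/funext => x; apply/rowP => j; rewrite [LHS]/= IH mxE derive_coord.
    by congr ('D_ _ _ _); apply/funext => y; rewrite mxE.
  apply/derivable_coordP => k; under eq_fun do rewrite mxE.
  exact: (h k s).2.
move=> s; rewrite E; split.
  by apply/continuous_coordP => j; under eq_fun do rewrite mxE; exact: (h j s).1.
move=> i x; apply/derivable_coordP => j; under eq_fun do rewrite mxE.
exact: (h j s).2.
Qed.

Lemma smooth_fun_cst c : smooth_fun (cst c).
Proof.
have E s : exists d, iter_deriv s (cst c) = cst d.
  elim: s => [|i s [d IH]]; first by exists c.
  by exists 0; apply/funext => x; rewrite /= IH derive_cst.
move=> s; have [d ->] := E s; split; first exact: cst_continuous.
by move=> i x; exact: derivable_cst.
Qed.

Lemma smooth_fun_derive i f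
  : smooth_fun f -> smooth_fun (fun x => 'D_(base_vec i) f x).
Proof.
move=> sf s; have := sf (rcons s i).
by rewrite /iter_deriv foldr_rcons.
Qed.

(** A derivative of a product is a sum of products, so an induction on the number of derivatives
    does not close on a single product. It closes on the algebra generated by [G], which is stable
    under derivation as soon as the derivatives of the generators belong to it. *)
Inductive alg_span (G : (V -> R) -> Prop) : (V -> R) -> Prop :=
| alg_gen f : G f -> alg_span G f
| alg_add f g : alg_span G f -> alg_span G g -> alg_span G (f + g)
| alg_mul f g : alg_span G f -> alg_span G g -> alg_span G (f * g).

Lemma alg_span_smooth (G : (V -> R) -> Prop) :
  (forall f, G f -> continuous f /\ forall i x, derivable f x (base_vec i)) ->
  (forall f i, G f -> alg_span G (fun x => 'D_(base_vec i) f x)) ->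
  forall f, alg_span G f -> smooth_fun f.
Proof.
move=> G1 GD.
have C f : alg_span G f -> continuous f /\ forall i x, derivable f x (base_vec i).
  elim=> {f} [f /G1//|f g _ [cf df] _ [cg dg]|f g _ [cf df] _ [cg dg]]; split.
  - by move=> x; exact: (continuousD (cf x) (cg x)).
  - by move=> i x; apply: derivableD.
  - by move=> x; exact: (continuousM (cf x) (cg x)).
  - by move=> i x; apply: derivableM.
have D f i : alg_span G f -> alg_span G (fun x => 'D_(base_vec i) f x).
  elim=> {f} [f /GD//|f g af IHf ag IHg|f g af IHf ag IHg].
    rewrite (_ : (fun x => _) = (fun x => 'D_(base_vec i) f x) + (fun x =>
      'D_(base_vec i) g x)); first exact: alg_add.
    by apply/funext => x; rewrite deriveD//; [exact: (C _ af).2|exact: (C _ ag).2].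
  rewrite (_ : (fun x => _) = f * (fun x =>
    'D_(base_vec i) g x) + g * (fun x => 'D_(base_vec i) f x)).
    by apply: alg_add; exact: alg_mul.
  by apply/funext => x; rewrite deriveM//; [exact: (C _ af).2|exact: (C _ ag).2].
move=> f af s; apply: C; elim: s => //= i s IH.
exact: D.
Qed.

Section logistic.
Variable (b c : R) (i0 : 'I_N).

Definition logistic (x : V) : R := sigmoid (b * x ord0 i0 + c).

Lemma logistic_gt0 x : 0 < logistic x.
Proof. exact: sigmoid_gt0. Qed.

Lemma logistic_lt1 x : logistic x < 1.
Proof. exact: sigmoid_lt1. Qed.

Lemma coord_derive (x : V) i : is_derive x (base_vec i) (fun y
  : V => y ord0 i0) (i0 == i)%:R.
Proof.
have d : derivable (@id V) x (base_vec i) by exact: derivable_id.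
apply: DeriveDef; first by move/derivable_coordP : d; exact.
by rewrite -derive_coord// derive_id mxE eqxx.
Qed.

Let g (t : R) : R := sigmoid (b * t + c).

Lemma logistic_diff (x : V) : differentiable logistic x.
Proof.
apply: (@differentiable_comp _ _ _ _ (fun y : V => y ord0 i0) g).
  exact: differentiable_coord.
by apply/derivable1_diffP; have [] := sigmoid_affine_derive b c (x ord0 i0).
Qed.

Lemma logistic_derive (x : V) i : is_derive x (base_vec i) logistic
  (- (b * (i0 == i)%:R) * (logistic x * (1 - logistic x))).
Proof.
apply: DeriveDef; first exact/diff_derivable/logistic_diff.
have dg : differentiable g (x ord0 i0).
  by apply/derivable1_diffP; have [] := sigmoid_affine_derive b c (x ord0 i0).
have dp : differentiable (fun y : V => y ord0 i0) x by exact: differentiable_coord.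
rewrite deriveE; last exact: logistic_diff.
rewrite (_ : logistic = g \o (fun y : V => y ord0 i0))// diff_comp//=.
rewrite -(deriveE _ dp) diff1E//=.
have [_ ->] := coord_derive x i.
rewrite derive1E; have [_ ->] := sigmoid_affine_derive b c (x ord0 i0).
by rewrite /GRing.scale/= /g /logistic; ring.
Qed.

(* The partial derivatives of a logistic function are polynomials in it. *)
Lemma smooth_logisticM f : smooth_fun f -> smooth_fun (logistic * f).
Proof.
move=> sf.
pose G (h : V -> R) := smooth_fun h \/ h = logistic.
apply: (@alg_span_smooth G).
- move=> h [sh|->]; first by have := sh [::].
  split=> [x|i x]; first exact/differentiable_continuous/logistic_diff.
  exact/diff_derivable/logistic_diff.
- move=> h i [sh|->]; first by apply: alg_gen; left; exact: smooth_fun_derive.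
  rewrite (_ : (fun x =>
    _) = cst (- (b * (i0 == i)%:R)) * (logistic * (cst 1 + cst (-1) * logistic))).
    have l : alg_span G logistic by apply: alg_gen; right.
    have k d : alg_span G (cst d) by apply: alg_gen; left; exact: smooth_fun_cst.
    by do ?[apply: alg_mul => //|apply: alg_add => //].
  apply/funext => x; have [_ ->] := logistic_derive x i.
  by rewrite /GRing.mul/= /GRing.add/= mulN1r.
- by apply: alg_mul; apply: alg_gen; [right|left].
Qed.

End logistic.

End smooth.

(** Only one directional derivative is assumed, so the argument works on difference quotients: the
    one at [h] is [b] times that of [f] at [b * h], and [b != 0] keeps [b * h] in the punctured
    neighbourhood. *)
Lemma derive_affine {R : realType} {V W : normedModType R} (f : V -> W)
    (b : R) (w x v : V) : b != 0 -> derivable f (b *: x + w) v ->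
  is_derive x v (fun y => f (b *: y + w)) (b *: 'D_v f (b *: x + w)).
Proof.
move=> b0 df.
have bh : (b * h) @[h --> (0:R)^'] --> (0:R)^'.
  move=> A [e /= e0 eA]; exists (e / `|b|) => /= [|h].
    by rewrite divr_gt0 ?normr_gt0.
  rewrite /= sub0r normrN => hb h0; apply: eA; last by rewrite mulf_neq0.
  by rewrite /= sub0r normrN normrM mulrC -ltr_pdivlMr ?normr_gt0.
have key : (h^-1 *: (((fun y =>
  f (b *: y + w)) \o shift x) (h *: v) - f (b *: x + w)))
    @[h --> (0:R)^'] --> b *: 'D_v f (b *: x + w).
  rewrite (_ : (fun h => _) = (fun h => b *:
      ((b * h)^-1 *: ((f \o shift (b *: x + w)) ((b * h) *: v) - f (b *: x + w))))).
    by apply: cvgZl_tmp; exact: (cvg_comp _ _ bh df).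
  apply/funext => h /=.
  rewrite [RHS]scalerA invfM mulrA mulfV// mul1r.
  have -> // : b *: (h *: v + x) + w = (b * h) *: v + (b *: x + w).
  by rewrite scalerDr scalerA addrA.
by apply: DeriveDef; [apply/cvg_ex;
  exists (b *: 'D_v f (b *: x + w))|exact/cvg_lim].
Qed.

(** * Test fields and first properties of the perimeter *)

Section test_fields.
Context {R : realType} {N : nat}.
Local Notation V := 'rV[R]_N.
Local Notation mu := (@borel_lebesgue_rV R N).
Local Notation leb := (@lebesgue_rV R N).
Local Notation carV := (caratheodory_type (mu^*)%mu).
Implicit Types (xi : V -> V) (C E : set V).

Lemma continuous_divergence xi : smooth xi -> continuous (divergence xi).
Proof.
move=> /smooth_coordP sxi; rewrite /divergence.
apply: continuous_big => [|i _]; first exact: add_continuous.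
exact: (sxi i [:: i]).1.
Qed.

Lemma support_eq0 xi x : ~ closure [set x | xi x != 0] x -> \near x, xi x = 0.
Proof.
move=> h; have : open (~` closure [set x | xi x != 0])
  by exact/closed_openC/closed_closure.
rewrite openE => /(_ x h); apply: filterS => y hy; apply/eqP/negPn/negP => xy.
by apply: hy; exact: subset_closure.
Qed.

Lemma derive_support0 xi x i j : ~ closure [set x | xi x != 0] x ->
  'D_(base_vec i) (fun y => xi y ord0 j) x = 0.
Proof.
move=> /support_eq0 h.
rewrite (_ : 0 = 'D_(base_vec i) (cst 0) x); last by rewrite derive_cst.
apply: near_eq_derive; apply: filterS h => y ->.
by rewrite mxE.
Qed.

Lemma divergence_support0 xi x : ~ closure [set x | xi x != 0] x ->
  divergence xi x = 0.
Proof. by move=> h; rewrite /divergence big1// => i _; rewrite derive_support0. Qed.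

Lemma divergence_out C xi x : test_field C xi -> ~ C° x -> divergence xi x = 0.
Proof. by move=> [_ _ sC _] Cx; apply: divergence_support0 => /sC. Qed.

Lemma compact_support_bounded (K : set V) (f : V -> R)
  : compact K -> continuous f ->
  (forall x, ~ K x -> f x = 0) -> exists2 M, 0 <= M & forall x, `|f x| <= M.
Proof.
move=> cK cf f0.
have /compact_bounded[M [_ hM]] : compact (f @` K).
  by apply: continuous_compact => //; exact: continuous_subspaceT.
exists (`|M| + 1) => [|x]; first by rewrite addr_ge0.
have [Kx|/f0 ->] := pselect (K x); last by rewrite normr0 addr_ge0.
by apply: (hM (`|M| + 1)); [rewrite ltr_pwDr// ler_norm|exists x].
Qed.

Lemma divergence_bounded C xi : test_field C xi ->
  exists2 M, 0 <= M & forall x, `|divergence xi x| <= M.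
Proof.
move=> [sxi cK _ _]; apply: (@compact_support_bounded _ (divergence xi) cK).
  exact: continuous_divergence.
exact: divergence_support0.
Qed.

Lemma divergence_measurable C xi E : test_field C xi ->
  measurable_fun (E : set carV) (divergence xi).
Proof.
move=> [sxi _ _ _]; apply: (@measurable_funS _ _ _ _ setT) => //.
by apply: continuous_lebesgue_measurable; exact: continuous_divergence.
Qed.

Lemma divergence_integrable C xi E : test_field C xi -> lebesgue_measurable E ->
  (leb E < +oo)%E -> leb.-integrable E (EFin \o divergence xi).
Proof.
move=> txi mE Eoo; apply: measurable_bounded_integrable => //.
  exact: divergence_measurable txi.
have [M M0 hM] := divergence_bounded txi.
by exists M; split=> [|y My x _];
  [rewrite num_real|exact: le_trans (hM x) (ltW My)].
Qed.

Lemma perimeter_ub C E xi : test_field C xi ->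
  (\int[leb]_(x in E) (divergence xi x)%:E <= perimeter C E)%E.
Proof. by move=> txi; apply: ereal_sup_ubound; exists xi. Qed.

Lemma perimeter_le C E (y : \bar R) :
  (forall xi, test_field C xi -> (\int[leb]_(x in E) (divergence xi x)%:E <=
    y)%E) ->
  (perimeter C E <= y)%E.
Proof. by move=> h; apply: ge_ereal_sup => _ [xi txi <-]; exact: h. Qed.

Lemma test_field0 C : test_field C (cst 0).
Proof.
have E0 : [set x : V | (cst 0 x : V) != 0] = set0.
  by apply/seteqP; split => // x /=; rewrite eqxx.
split.
- apply/smooth_coordP => j; rewrite (_ : (fun _ => _) = cst 0).
    exact: smooth_fun_cst.
  by apply/funext => y; rewrite mxE.
- by rewrite E0 closure0; exact: compact0.
- by rewrite E0 closure0.
- move=> x; rewrite /euclidean_norm big1 ?sqrtr0// => i _.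
  by rewrite mxE expr0n.
Qed.

Lemma perimeter_ge0 C E : (0 <= perimeter C E)%E.
Proof.
apply: le_trans (perimeter_ub E (test_field0 C)).
rewrite integral_ge0// => x _; rewrite lee_fin /divergence sumr_ge0// => i _.
rewrite (_ : (fun y => _) = cst 0) ?derive_cst//.
by apply/funext => y; rewrite mxE.
Qed.

Lemma perimeterU_le C E F : lebesgue_measurable E -> lebesgue_measurable F ->
  (leb E < +oo)%E -> (leb F < +oo)%E -> [disjoint E & F] ->
  (perimeter C (E `|` F) <= perimeter C E + perimeter C F)%E.
Proof.
move=> mE mF Eoo Foo EF; apply: perimeter_le => xi txi.
have mU : lebesgue_measurable (E `|` F) by exact: measurableU.
rewrite integral_setU//; last exact/measurable_EFinP/divergence_measurable/txi.
by apply: leeD; exact: perimeter_ub.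
Qed.

Lemma coord_le_euclidean (x : V) i : `|x ord0 i| <= euclidean_norm x.
Proof.
rewrite -sqrtr_sqr /euclidean_norm ler_wsqrtr// (bigD1 i)//= lerDl.
by rewrite sumr_ge0// => j _; exact: sqr_ge0.
Qed.

Lemma euclidean_normZ (a : R) (x : V) : 0 <= a ->
  euclidean_norm (a *: x) = a * euclidean_norm x.
Proof.
move=> a0; rewrite /euclidean_norm -[in RHS](ger0_norm a0) -sqrtr_sqr -sqrtrM
  ?sqr_ge0//.
by rewrite mulr_sumr; congr Num.sqrt; apply: eq_bigr => i _; rewrite mxE exprMn.
Qed.

End test_fields.

(** * Perimeter under affine maps sending the body into itself *)

Section affine_perimeter.
Context {R : realType} {N : nat}.
Local Notation V := 'rV[R]_N.
Local Notation mu := (@borel_lebesgue_rV R N).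
Local Notation leb := (@lebesgue_rV R N).
Local Notation carV := (caratheodory_type (mu^*)%mu).
Implicit Types (xi : V -> V) (C E : set V).

Lemma continuous_cstM (T : topologicalType) (c : R) (f : T -> R) :
  continuous f -> continuous (fun x => c * f x).
Proof. by move=> cf x; apply: cvgM; [exact: cvg_cst|exact: cf]. Qed.

Lemma continuous_affine (b : R) (w : V) : continuous (fun y : V => b *: y + w).
Proof.
apply/continuous_coordP => j; under eq_fun do rewrite !mxE.
move=> x; apply: (@continuousD _ _ _ (fun y : V => b * y ord0 j) (cst (w ord0 j))).
  by apply: (@continuousM _ _ (cst b) (fun y : V => y ord0 j));
    [exact: cst_continuous|exact: coord_continuous].
exact: cst_continuous.
Qed.

Lemma smooth_affine xi (b : R) (w : V) : b != 0 -> smooth xi ->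
  smooth (fun y => xi (b *: y + w)).
Proof.
move=> b0 sxi.
have E s : iter_partial s (fun y => xi (b *: y + w)) =
    (fun y => b ^+ size s *: iter_partial s xi (b *: y + w)).
  elim: s => [|i s IH]; first by apply/funext => y; rewrite expr0 scale1r.
  apply/funext => y; rewrite [LHS]/= IH.
  have d := derive_affine b0 ((sxi s).2 i (b *: y + w)).
  rewrite (_ : (fun z => _) = (b ^+ size s \*: (fun z =>
    iter_partial s xi (b *: z + w))))//.
  rewrite deriveZ; last by case: d.
  by case: d => _ ->; rewrite scalerA -exprSr.
move=> s; rewrite E; split.
  apply/continuous_coordP => j; under eq_fun do rewrite mxE.
  apply: continuous_cstM => x.
  apply: (@continuous_comp _ _ _ (fun y
    : V => b *: y + w) (fun z => iter_partial s xi z ord0 j)).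
    exact: continuous_affine.
  by move: (sxi s).1 => /continuous_coordP/(_ j); exact.
move=> i x.
rewrite (_ : (fun z => _) = (b ^+ size s \*: (fun z =>
  iter_partial s xi (b *: z + w))))//.
by apply: derivableZ; have [] := derive_affine b0 ((sxi s).2 i (b *: x + w)).
Qed.

Lemma divergence_affine xi (b : R) (w : V) y : b != 0 -> smooth xi ->
  divergence (fun y => xi (b *: y + w)) y = b * divergence xi (b *: y + w).
Proof.
move=> b0 /smooth_coordP sxi; rewrite /divergence mulr_sumr; apply: eq_bigr => i _.
by have [_ ->] := derive_affine b0 ((sxi i [::]).2 i (b *: y + w)).
Qed.

Variables (C : set V) (a : R) (w : V).
Hypothesis a0 : 0 < a.
Let T (x : V) : V := a *: x + w.
Let S (x : V) : V := a^-1 *: x + - (a^-1 *: w).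
Hypothesis TC : forall x, C x -> C (T x).

Let ST x : S (T x) = x. Proof. exact: affineK. Qed.
Let TS x : T (S x) = x. Proof. exact: affineVK. Qed.

Lemma interior_affine x : C° x -> C° (T x).
Proof.
move=> Cx; rewrite /interior.
have : nbhs (T x) (S @^-1` C).
  by have := @continuous_affine a^-1 (- (a^-1 *: w)) (T x); apply;
    rewrite -/(S (T x)) ST.
by apply: filterS => y /TC; rewrite TS.
Qed.

(** The support moves to its image under [T], which stays in the interior because [T] is a
    homeomorphism sending [C] into itself. *)
Lemma test_field_affine xi : test_field C xi -> test_field C (xi \o S).
Proof.
move=> [sxi cK KC xi1].
have cTK : compact (T @` closure [set x | xi x != 0]).
  by apply: continuous_compact => //; apply: continuous_subspaceT;
    exact: continuous_affine.
have sub : closure [set x | (xi \o S) x != 0] `<=` T @` closure [set x | xi x != 0].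
  have /closure_id -> : closed (T @` closure [set x | xi x != 0]).
    by apply: compact_closed => //; exact: norm_hausdorff.
  apply: closure_subset => x /= Sx; exists (S x); last exact: TS.
  exact: subset_closure.
split.
- by apply: smooth_affine => //; rewrite invr_neq0// gt_eqF.
- apply: subclosed_compact cTK sub; exact: closed_closure.
- by move=> x /sub[y /KC Cy <-]; exact: interior_affine.
- by move=> x; exact: xi1.
Qed.

(** Serves both ways of losing volume: [a = 1], [w = t *: u] translates [E] by [- t *: u] and
    intersects with [C]; [w = 0] shrinks [E] by the factor [a]. *)
Definition affine_trace (E : set V) : set V := [set x | C x /\ E (T x)].

Lemma affine_traceE E : affine_trace E = C `&` (T @^-1` E).
Proof. by apply/seteqP; split. Qed.

(** Changing variables turns the integral of [divergence xi] over the trace into [a / a ^+ N] times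
    that of [divergence (xi \o S)] over [E], and this factor is at most 1. *)
Lemma perimeter_affine E : lebesgue_measurable E -> (leb E < +oo)%E ->
  1 <= a -> (0 < N)%N ->
  (perimeter C (affine_trace E) <= perimeter C E)%E.
Proof.
move=> mE Eoo a1 N0; apply: perimeter_le => xi txi.
have aI : a^-1 != 0 by rewrite invr_neq0// gt_eqF.
have txiS := test_field_affine txi.
(* Intersecting with [C] does not change the integral, since the divergence vanishes outside the
   interior of [C]. *)
have -> : (\int[leb]_(x in affine_trace E) (divergence xi x)%:E =
          \int[leb]_(x in T @^-1` E) (divergence xi x)%:E)%E.
  rewrite integral_mkcond [RHS]integral_mkcond; apply: eq_integral => x _.
  rewrite /patch; have [Cx|Cx] := pselect (C x).
    suff -> : (x \in affine_trace E) = (x \in T @^-1` E) by [].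
    by apply/idP/idP => [/set_mem[_ Ex]|/set_mem Ex]; apply/mem_set.
  rewrite (divergence_out txi); first by rewrite !if_same.
  by move=> /interior_subset.
have [sxi _ _ _] := txi.
pose h y := a * divergence (xi \o S) y.
have hE x : divergence xi x = h (T x).
  rewrite /h (divergence_affine (- (a^-1 *: w)) (T x) aI sxi) mulrA mulfV
    ?gt_eqF// mul1r.
  by rewrite -/(S (T x)) ST.
have ih : leb.-integrable E (EFin \o h).
  rewrite (_ : EFin \o h = (fun x => a%:E * (EFin \o divergence (xi \o S)) x)%E) //.
  apply: integrableZl => //; exact: divergence_integrable txiS _ _.
have mh : measurable_fun (setT : set carV) h.
  apply: measurable_funM; first exact: measurable_cst.
  exact: divergence_measurable txiS.
have := integral_affine w a0 mE mh ih.
set X := (\int[leb]_(x in _) _)%E => HX.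
have -> : (\int[leb]_(x in T @^-1` E) (divergence xi x)%:E = X)%E.
  by apply: eq_integral => x _; rewrite hE.
have : (a%:E * \int[leb]_(x in E) (divergence (xi \o S) x)%:E = (a ^+ N)%:E * X)%E.
  by rewrite HX -integralZl//; exact: divergence_integrable txiS _ _.
have := perimeter_ub E txiS.
have : (\int[leb]_(x in E) (divergence (xi \o S) x)%:E)%E \is a fin_num.
  by apply: integrable_fin_num => //; exact: divergence_integrable txiS _ _.
case: (\int[leb]_(x in E) _)%E => // y _ yP /(congr1 (fun z =>
  ((a ^+ N)^-1%:E * z)%E)).
have aN : 0 < a ^+ N by rewrite exprn_gt0.
rewrite !muleA -!EFinM mulVf ?gt_eqF// mul1e => <-.
(* A factor below 1 increases a negative integral, so that case is compared with 0 instead. *)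
have [y0|y0] := leP 0 y.
  apply: le_trans yP; rewrite lee_fin ler_piMl// ler_pdivrMl// mulr1.
  by rewrite -[leLHS]expr1 ler_weXn2l.
apply: le_trans (perimeter_ge0 C E); rewrite lee_fin.
by rewrite pmulr_rle0 ?ltW// mulr_gt0// invr_gt0.
Qed.

Lemma affine_trace_measurable E : lebesgue_measurable C -> lebesgue_measurable E ->
  lebesgue_measurable (affine_trace E).
Proof.
move=> mC mE; rewrite affine_traceE; apply: measurableI => //.
exact: lebesgue_measurable_affine.
Qed.

(** By injectivity of [T]: it maps the trace onto the part of [E] inside the image of [C]. *)
Lemma affine_trace_volume E :
  ((a ^+ N)%:E * leb (affine_trace E) = leb (E `&` [set T x | x in C]))%E.
Proof.
rewrite -(@lebesgue_rV_affine _ _ a w (E `&` _))//; congr (_ * leb _)%E.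
apply/seteqP; split => [x [Cx Ex]|x [Ex [y Cy e]]]; first by split=> //; exists x.
split; last exact: Ex.
by rewrite -(etrans (esym (ST y)) (etrans (congr1 S e) (ST x))).
Qed.

End affine_perimeter.

(** * Boxes and the perimeter of a cube *)

Section box.
Context {R : realType} {N : nat}.
Local Notation V := 'rV[R]_N.
Local Notation mu := (@borel_lebesgue_rV R N).
Local Notation leb := (@lebesgue_rV R N).
Local Notation carV := (caratheodory_type (mu^*)%mu).
Implicit Types (xi : V -> V) (C E : set V) (f : V -> R).

Lemma bounded_integrable E f (M : R) : lebesgue_measurable E -> (leb E < +oo)%E ->
  measurable_fun (setT : set carV) f -> (forall x, `|f x| <= M) ->
  leb.-integrable E (EFin \o f).
Proof.
move=> mE Eoo mf fM; apply: measurable_bounded_integrable => //.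
  exact: measurable_funS mf.
by exists M; split=> [|y My x _];
  [rewrite num_real|exact: le_trans (fM x) (ltW My)].
Qed.

Lemma Rintegral_bound E f (M : R) : lebesgue_measurable E -> (leb E < +oo)%E ->
  measurable_fun (setT : set carV) f -> (forall x, `|f x| <= M) ->
  `|\int[leb]_(x in E) f x| <= M * fine (leb E).
Proof.
move=> mE Eoo mf fM.
have intf := bounded_integrable mE Eoo mf fM.
apply: le_trans (le_normr_Rintegral mE intf) _.
rewrite -Rintegral_cst//; apply: le_Rintegral => //.
  exact: integrable_norm.
by apply: (@bounded_integrable _ (cst M) `|M|) => //; exact: measurable_cst.
Qed.

Lemma Rintegral_diff_bound A B f : lebesgue_measurable A -> lebesgue_measurable B ->
  (leb A < +oo)%E -> (leb B < +oo)%E ->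
  measurable_fun (setT : set carV) f -> (forall x, `|f x| <= 1) ->
  `|\int[leb]_(x in A) f x - \int[leb]_(x in B) f x| <=
  fine (leb (A `\` B)) + fine (leb (B `\` A)).
Proof.
move=> mA mB Aoo Boo mf f1.
have split_ A' B' : lebesgue_measurable A' -> lebesgue_measurable B' ->
    (leb A' < +oo)%E ->
    \int[leb]_(x in A') f x = \int[leb]_(x in A' `&` B') f x + \int[leb]_(x in
      A' `\` B') f x.
  move=> mA' mB' A'oo; rewrite -Rintegral_setU ?setUIDK//.
  - exact: measurableI.
  - exact: measurableD.
  - exact: bounded_integrable mf f1.
  - by apply/disj_setPS => x [[_ ?] [_]].
have bnd A' B' : lebesgue_measurable A' -> lebesgue_measurable B' ->
    (leb A' < +oo)%E -> `|\int[leb]_(x in A' `\` B') f x| <= fine (leb (A' `\` B')).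
  move=> mA' mB' A'oo; rewrite -[leRHS]mul1r; apply: Rintegral_bound => //.
    exact: measurableD.
  by apply: le_lt_trans A'oo; apply: le_measure => //; rewrite ?inE//;
    exact: measurableD.
rewrite (split_ A B)// (split_ B A)// (setIC B A).
set x := Rintegral _ _ _; set y := Rintegral _ _ _; set z := Rintegral _ _ _.
rewrite (_ : x + y - (x + z) = y - z); last by ring.
by apply: le_trans (ler_normB _ _) _; apply: lerD; exact: bnd.
Qed.

Definition box (l h : 'I_N -> R)
  : set V := [set x | forall i, l i <= x ord0 i < h i].

Lemma boxE l h : box l h = [set x | forall i, `[l i, h i[%classic (x ord0 i)].
Proof. by apply/seteqP; split => x /= xb i; have := xb i; rewrite in_itv. Qed.

Lemma box_measurable l h : lebesgue_measurable (box l h).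
Proof.
rewrite boxE; apply: borel_lebesgue_measurable.
by apply: (@measurable_rectangle _ _ (fun i => `[l i, h i[%classic)).
Qed.

Lemma box_volume l h : (forall i, l i <= h i) ->
  leb (box l h) = (\prod_i (h i - l i))%:E.
Proof.
move=> lh; rewrite boxE lebesgue_rV_borel; last first.
  by apply: (@measurable_rectangle _ _ (fun i => `[l i, h i[%classic)).
rewrite (@borel_lebesgue_rectangle _ _ (fun i => `[l i, h i[%classic))//.
rewrite -prodEFin; apply: eq_bigr => i _.
rewrite lebesgue_measure_itv/= lte_fin; case: ltP => // hl.
by rewrite (_ : h i - l i = 0)//; apply/eqP; rewrite subr_eq0 eq_le hl lh.
Qed.

(** Mean value theorem along a line in direction [base_vec i]; it provides the dominating constant
    in [cube_flux]. *)
Lemma difference_quotient_bound f i (M : R) (x : V) (h : R) : 0 < h ->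
  (forall y, derivable f y (base_vec i)) ->
  (forall y, `|'D_(base_vec i) f y| <= M) ->
  `|h^-1 * (f (x + h *: base_vec i) - f x)| <= M.
Proof.
move=> h0 df fM; pose e : V := base_vec i; pose g (t : R) := f (t *: e + x).
have dg (t : R) : is_derive t (1 : R) g ('D_e f (t *: e + x)).
  have gE : (fun s : R => s^-1 *: ((g \o shift t) (s *: (1 : R)) - g t)) =
      (fun s : R => s^-1 *: ((f \o shift (t *: e + x)) (s *: e) - f (t *: e + x))).
    by apply/funext => s; rewrite /g /= [_ *: 1]mulr1 scalerDl addrA.
  by apply: DeriveDef; [rewrite /derivable gE; exact: df|rewrite /derive gE].
have [|c _] := @MVT _ g (fun t => 'D_e f (t *: e + x)) 0 h h0 (fun t _ => dg t).
  by apply: derivable_within_continuous => t _; have [] := dg t.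
rewrite /g scale0r add0r subr0 (addrC (h *: e)) => ->.
by rewrite mulrCA mulVf ?gt_eqF// mulr1.
Qed.

Definition cube (l : 'I_N -> R) (r : R) : set V := box l (fun j => l j + r).

Lemma cube_volume l r : 0 <= r -> leb (cube l r) = (r ^+ N)%:E.
Proof.
move=> r0; rewrite box_volume => [|i]; last by rewrite lerDl.
by under eq_bigr do rewrite addrAC subrr add0r; rewrite prodr_const card_ord.
Qed.

Let slab (l : 'I_N -> R) (r : R) (i : 'I_N) (t h : R) : set V :=
  box (fun j => if j == i then t else l j) (fun j =>
    if j == i then t + h else l j + r).

Let slab_volume l r i t h : 0 <= r -> 0 <= h ->
  leb (slab l r i t h) = (h * r ^+ N.-1)%:E.
Proof.
move=> r0 h0; rewrite box_volume => [|j]; last by case: ifP; rewrite lerDl.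
rewrite (bigD1 i)//= eqxx addrAC subrr add0r; congr (_ * _)%:E.
rewrite (eq_bigr (fun=> r)) => [|j /negbTE ->]; last by rewrite addrAC subrr add0r.
by rewrite prodr_const; congr (_ ^+ _); rewrite -[in RHS](card_ord N) -(cardC1 i).
Qed.

(** A one-coordinate divergence theorem without surface integrals. The integral of the derivative is
    the limit of the difference of the integrals of [f] over the shifted and the original cube,
    divided by the shift [h]. Those two cubes differ by a set of volume at most
    [2 * h * r ^+ N.-1]. *)
Lemma cube_flux f i (M : R) l r
  : 0 < r -> continuous f -> (forall x, `|f x| <= 1) ->
  (forall y, derivable f y (base_vec i)) ->
  continuous (fun y => 'D_(base_vec i) f y) ->
  (forall y, `|'D_(base_vec i) f y| <= M) ->
  `|\int[leb]_(x in cube l r) 'D_(base_vec i) f x| <= 2 * r ^+ N.-1.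
Proof.
move=> r0 cf f1 df cD DM.
set Q := cube l r; pose e : V := base_vec i.
have mQ : lebesgue_measurable Q by exact: box_measurable.
have Qoo : (leb Q < +oo)%E by rewrite cube_volume ?ltry// ltW.
have mf := continuous_lebesgue_measurable cf.
have mfe (h : R) : measurable_fun (setT : set carV) (fun x
  : V => f (1 *: x + h *: e)).
  apply: continuous_lebesgue_measurable => x.
  apply: (@continuous_comp _ _ _ (fun x : V => 1 *: x + h *: e) f).
    exact: continuous_affine.
  exact: cf.
pose q (h : R) := h^-1 * (\int[leb]_(x in Q) f (1 *: x + h *: e) - \int[leb]_(x
  in Q) f x).
have qle (h : R) : 0 < h -> `|q h| <= 2 * r ^+ N.-1.
  move=> h0; pose Qh := box (fun j => l j + h * (j == i)%:R) (fun j =>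
    l j + r + h * (j == i)%:R).
  have QhE : (fun x : V => 1 *: x + h *: e) @^-1` Qh = Q.
    apply/seteqP; split => x /= xQ j; have := xQ j; rewrite /Qh /e !mxE /=.
      by rewrite mul1r lerD2r ltrD2r.
    by rewrite mul1r lerD2r ltrD2r.
  have mQh : lebesgue_measurable Qh by exact: box_measurable.
  have Qhoo : (leb Qh < +oo)%E.
    by rewrite -(@lebesgue_rV_affine _ _ 1 (h *: e))// QhE expr1n mul1e.
  rewrite /q; have -> : \int[leb]_(x in Q) f (1 *: x + h *: e) = \int[leb]_(x
    in Qh) f x.
    rewrite /Rintegral -(integral_affine (h *: e) ltr01 mQh mf).
      by rewrite expr1n mul1e QhE.
    exact: bounded_integrable mf f1.
  rewrite normrM gtr0_norm ?invr_gt0// ler_pdivrMl//.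
  apply: le_trans (Rintegral_diff_bound _ _ _ _ mf f1) _ => //.
  have sub A B : lebesgue_measurable A -> lebesgue_measurable B -> (leb B <
    +oo)%E -> A `<=` B -> fine (leb A) <= fine (leb B).
    move=> mA mB Boo AB; have AB'
      : (leb A <= leb B)%E by apply: le_measure => //; rewrite inE.
    rewrite fine_le// ge0_fin_numE//; exact: le_lt_trans AB' _.
  have sv t := slab_volume l i t (ltW r0) (ltW h0).
  (* The shifted cube gains a slab of thickness [h] beyond the upper face and loses one at the lower
     face. *)
  rewrite (_ : h * (2 * r ^+ N.-1) = fine (leb (slab l r i (l i + r) h)) + fine
    (leb (slab l r i (l i) h))); last first.
    by rewrite !sv/=; ring.
  apply: lerD; apply: sub; rewrite ?sv ?ltry//; try exact: measurableD;
    try exact: box_measurable.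
    move=> x [xQh xQ] j; have := xQh j; case: eqP => [->|_];
      last by rewrite mulr0 !addr0.
    rewrite mulr1 => /andP[h1 h2]; rewrite h2 andbT leNgt; apply/negP => h3;
      apply: xQ => k.
    have := xQh k; case: eqP => [-> _|_]; last by rewrite mulr0 !addr0.
    by rewrite h3 andbT (le_trans _ h1)// lerDl ltW.
  move=> x [xQ xQh] j; have := xQ j; case: eqP => [->|//].
  move=> /andP[h1 h2]; rewrite h1/= ltNge; apply/negP => h3; apply: xQh => k.
  have := xQ k; case: eqP => [-> _|_]; last by rewrite mulr0 !addr0.
  by rewrite mulr1 h3/= (lt_trans h2)// ltrDl.
pose hk (k : nat) : R := k.+1%:R^-1.
have hk0 k : 0 < hk k by rewrite invr_gt0.
pose fk k (x : V) := (hk k)^-1 * (f (1 *: x + hk k *: e) - f x).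
have mfk k : measurable_fun (setT : set carV) (fk k).
  apply: measurable_funM; first exact: measurable_cst.
  by apply: measurable_funB; [exact: mfe|exact: mf].
have fkM k x : `|fk k x| <= M.
  by rewrite /fk scale1r; exact: difference_quotient_bound.
have mD : measurable_fun (setT : set carV) (fun y => 'D_(base_vec i) f y).
  exact: continuous_lebesgue_measurable.
have hk_cvg : hk k @[k --> \oo] --> (0 : R)^'.
  move=> A [d /= d0 dA].
  have := near_infty_natSinv_lt (PosNum d0); apply: filterS => k kd;
    apply: dA => /=.
    by rewrite sub0r normrN gtr0_norm.
  by rewrite gt_eqF.
have fk_cvg x : fk k x @[k --> \oo] --> 'D_e f x.
  have := cvg_comp _ _ hk_cvg (df x); apply: cvg_trans; apply: near_eq_cvg.
  by apply: nearW => k; rewrite /fk /= scale1r (addrC x).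
have := @dominated_cvg _ carV R leb Q mQ (fun k x => (fk k x)%:E) (fun x =>
  ('D_e f x)%:E) (fun=> M%:E).
have fkq k : (\int[leb]_(x in Q) (fk k x)%:E = (q (hk k))%:E)%E.
  rewrite -(@fineK _ (\int[leb]_(x in Q) (fk k x)%:E)%E); last first.
    apply: integrable_fin_num => //; exact: bounded_integrable (mfk k) (fkM k).
  congr EFin; rewrite -/(Rintegral leb Q (fk k)) /fk RintegralZl//.
    congr (_ * _); apply: RintegralB => //;
      first exact: bounded_integrable (mfe _) (fun x => f1 _).
    exact: bounded_integrable mf f1.
  apply: (@bounded_integrable _ _ 2) => //.
    by apply: measurable_funB; [exact: mfe|exact: mf].
  move=> x; apply: le_trans (ler_normB _ _) _.
  by have := f1 x; have := f1 (1 *: x + hk k *: e); lra.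
have iM : leb.-integrable Q (fun=> M%:E).
  by apply: (@bounded_integrable _ (cst M) `|M|) => //; exact: measurable_cst.
have mfkE k : measurable_fun (Q : set carV) (fun x => (fk k x)%:E).
  by apply/measurable_EFinP; exact: measurable_funS (mfk k).
have cfkE (x : carV) : Q x -> (fk k x)%:E @[k --> \oo] --> ('D_e f x)%:E.
  by move=> _; apply: cvg_EFin; [exact: nearW|exact: fk_cvg].
move=> /(_ mfkE cfkE (fun _ _ => erefl) iM); under eq_fun do rewrite fkq.
move=> /(_ (fun k x _ => fkM k x)) qc.
have iD := bounded_integrable mQ Qoo mD DM.
rewrite -lee_fin EFin_normr_Rintegral//.
have qca : `|(q (hk k))%:E|%E @[k --> \oo] --> `|\int[leb]_(x in Q) ('D_e f
  x)%:E|%E.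
  exact: cvg_abse.
rewrite -(cvg_lim _ qca)//; apply: lime_le; first by apply/cvg_ex; eexists;
  exact: qca.
by apply: nearW => k; rewrite /= lee_fin; exact: qle.
Qed.

(** Each component of a test field is bounded by 1, so each coordinate direction contributes at most
    the area of its two faces. *)
Lemma cube_perimeter C l r : 0 < r ->
  (perimeter C (cube l r) <= (N%:R * (2 * r ^+ N.-1))%:E)%E.
Proof.
move=> r0; apply: perimeter_le => xi txi.
have [/smooth_coordP sxi cK KC xi1] := txi.
have mQ : lebesgue_measurable (cube l r) by exact: box_measurable.
have Qoo : (leb (cube l r) < +oo)%E by rewrite cube_volume ?ltry// ltW.
pose d i y := 'D_(base_vec i) (fun y => xi y ord0 i) y.
have bd i : exists2 M, 0 <= M & forall x, `|d i x| <= M.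
  apply: (compact_support_bounded cK); first exact: (sxi i [:: i]).1.
  by move=> x; exact: derive_support0.
have md i : measurable_fun (setT : set carV) (d i).
  by apply: continuous_lebesgue_measurable; exact: (sxi i [:: i]).1.
have di i : leb.-integrable (cube l r) (EFin \o d i).
  by have [M _ dM] := bd i; exact: bounded_integrable (md i) dM.
rewrite (_ : (\int[leb]_(x in cube l r) (divergence xi x)%:E =
    \int[leb]_(x in cube l r) \sum_(i < N) (d i x)%:E)%E); last first.
  by apply: eq_integral => x _; rewrite /divergence sumEFin.
rewrite integral_sum//.
rewrite (_ : N%:R * _ = \sum_(i < N) (2 * r ^+ N.-1)); last first.
  by rewrite sumr_const card_ord mulr_natl.
rewrite -sumEFin; apply: lee_sum => i _.
have [M _ dM] := bd i.
rewrite -(@fineK _ (\int[leb]_(x in _) _)%E);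
  last exact: (integrable_fin_num mQ (di i)).
rewrite lee_fin; apply: le_trans (ler_norm _) _.
apply: (@cube_flux (fun y => xi y ord0 i) i M) => //.
- exact: (sxi i [::]).1.
- by move=> x; apply: le_trans (coord_le_euclidean _ _) (xi1 x).
- by move=> y; exact: (sxi i [::]).2.
- exact: (sxi i [:: i]).1.
Qed.

End box.

(** * Sigma-finiteness of the completed measure, as Tonelli's theorem requires *)

Section sigma_finite_completed.
Context d (T : measurableType d) (R : realType).
Variable mu : {sigma_finite_measure set T -> \bar R}.
HB.instance Definition _ := Measure_isSigmaFinite.Build _ _ _
  (@completed_measure_extension _ _ R mu)
  (@completed_measure_extension_sigma_finite _ _ _ mu (sigma_finiteT mu)).
End sigma_finite_completed.

(** * Steep cutoffs and the existence of cheap levels *)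

Section steep_sigmoid.
Context {R : realType}.

(* Subtracting [j.+1] makes [sigmoid (steep j s t)] tend to 1 also at [t = s]. *)
Definition steep (j : nat) (s t : R) : R := j.+1%:R ^+ 2 * (t - s) - j.+1%:R.

(** The derivative of [sigmoid (steep j s t)] in the level [s], and minus its derivative in [t]: as
    a function of [t] it is the cost density of the cutoff at level [s]. *)
Definition steep_bump (j : nat) (s t : R) : R :=
  j.+1%:R ^+ 2 * (sigmoid (steep j s t) * (1 - sigmoid (steep j s t))).

Lemma steep_bump_ge0 j s t : 0 <= steep_bump j s t.
Proof.
rewrite mulr_ge0 ?exprn_ge0// mulr_ge0 ?ltW ?sigmoid_gt0// subr_gt0.
exact: sigmoid_lt1.
Qed.

Lemma steep_bump_le j s t : steep_bump j s t <= j.+1%:R ^+ 2.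
Proof.
rewrite ler_piMr ?exprn_ge0//; have := sigmoid_gt0 (steep j s t).
have := sigmoid_lt1 (steep j s t); set u := sigmoid _ => u1 u0.
by nra.
Qed.

Lemma steep_bump_continuous j s : continuous (steep_bump j s).
Proof.
move=> t; rewrite /steep_bump; apply: cvgM; first exact: cvg_cst.
have c : {for t, continuous (fun t => sigmoid (steep j s t))}.
  apply: (@continuous_comp _ _ _ (steep j s) sigmoid);
    last exact: continuous_sigmoid.
  apply: cvgB; last exact: cvg_cst; apply: cvgM; first exact: cvg_cst.
  by apply: cvgB; [exact: cvg_id|exact: cvg_cst].
by apply: cvgM => //; apply: cvgB => //; exact: cvg_cst.
Qed.

(** The value depends on [t - s] only; this turns continuity in [t] into continuity in [s]. *)
Lemma steep_bump_sym j s t : steep_bump j s t = steep_bump j (- t) (- s).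
Proof. by rewrite /steep_bump /steep opprK (addrC (- s)). Qed.

(** Integrated over levels, the bump gives an increment of a function with values between 0 and
    1. *)
Lemma steep_bump_mass j (S M t : R) : 0 < M ->
  (\int[lebesgue_measure]_(s in `[S, (S + M)%R]) (steep_bump j s t)%:E <= 1)%E.
Proof.
move=> M0; pose F s := sigmoid (- (j.+1%:R ^+ 2) * s + (j.+1%:R ^+ 2 * t -
  j.+1%:R)).
have FE s : F s = sigmoid (steep j s t).
  by rewrite /F /steep; congr sigmoid; ring.
have dF (s : R) : is_derive s 1 F (steep_bump j s t).
  apply: is_derive_eq; first exact: sigmoid_affine_derive.
  by rewrite opprK -/(F s) FE.
have cb : continuous (fun s => steep_bump j s t).
  rewrite (_ : (fun s => _) = steep_bump j (- t) \o -%R);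
    last by apply/funext => s; rewrite steep_bump_sym.
  by move=> s; apply: continuous_comp;
    [exact: opp_continuous|exact: steep_bump_continuous].
have cF : continuous F.
  by move=> s; apply/differentiable_continuous/derivable1_diffP; have [] := dF s.
rewrite (@continuous_FTC2 _ _ F)//.
- rewrite -EFinB lee_fin !FE; have := sigmoid_gt0 (steep j S t).
  by have := sigmoid_lt1 (steep j (S + M) t); lra.
- by rewrite ltrDl.
- exact: continuous_subspaceT.
- split.
  + by move=> s _; have [] := dF s.
  + exact/cvg_at_right_filter/cF.
  + exact/cvg_at_left_filter/cF.
- by move=> s _; rewrite derive1E; have [_ ->] := dF s.
Qed.

Section cut_level.
Context d (T : measurableType d) (m : {sigma_finite_measure set T -> \bar R}).
Variables (D : set T) (y : T -> R).
Hypothesis mD : measurable D.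
Hypothesis Doo : (m D < +oo)%E.
Hypothesis my : measurable_fun setT y.

Let P := (measurableTypeR R * T)%type.

Lemma measurable_steep_bump2 j : measurable_fun (setT
  : set P) (fun p => steep_bump j p.1 (y p.2)).
Proof.
rewrite (_ : (fun p => _) = steep_bump j 0 \o (fun p : P => y p.2 - p.1));
  last first.
  by apply/funext => p; rewrite /steep_bump /steep /= subr0.
apply: (measurableT_comp (continuous_measurable_fun (@steep_bump_continuous j 0))).
apply: measurable_funB; last exact: measurable_fst.
by apply: measurableT_comp => //; exact: measurable_snd.
Qed.

Lemma cut_level (S eps : R) : 0 < eps -> exists2 s, S <= s &
  forall n, exists2 j, (n <= j)%N & (\int[m]_(x in D) (steep_bump j s (y x))%:E
    < eps%:E)%E.
Proof.
(* Makes [eps * M] equal to [m D + eps], strictly more than the cost [m D] shared by all levels. *)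
move=> e0; pose M := fine (m D) / eps + 1.
have M0 : 0 < M by rewrite ltr_wpDl// divr_ge0 ?fine_ge0 ?(ltW e0).
pose I : set (measurableTypeR R) := `[S, (S + M)%R]%classic.
have mI : measurable I by exact: measurable_itv.
pose G j (p : P) : \bar R := ((steep_bump j p.1 (y p.2) * \1_I p.1) * \1_D p.2)%:E.
have mG j : measurable_fun setT (G j).
  apply/measurable_EFinP; apply: measurable_funM; last first.
    by apply: measurableT_comp; [exact: measurable_indic|exact: measurable_snd].
  apply: measurable_funM; first exact: measurable_steep_bump2.
  by apply: measurableT_comp; [exact: measurable_indic|exact: measurable_fst].
have G0 j p : (0 <= G j p)%E.
  by rewrite lee_fin /= !indicE mulr_ge0// mulr_ge0// steep_bump_ge0.
pose F j s := (\int[m]_(x in D) (steep_bump j s (y x))%:E)%E.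
have FE j s : (\int[m]_x G j (s, x) = F j s * (\1_I s)%:E)%E.
  transitivity (\int[m]_(x in D) (steep_bump j s (y x) * \1_I s)%:E)%E.
    rewrite [in RHS]integral_mkcond; apply: eq_integral => x _;
      rewrite /G /patch /=.
    by rewrite (indicE _ D); case: ifPn; rewrite ?mulr1 ?mulr0.
  under eq_integral do rewrite EFinM.
  rewrite ge0_integralZr//.
  - apply/measurable_EFinP; apply: measurable_funTS.
    exact: (measurableT_comp (continuous_measurable_fun (@steep_bump_continuous
      j s)) my).
  - by move=> x _; rewrite lee_fin steep_bump_ge0.
have mF j : measurable_fun setT (fun s => F j s * (\1_I s)%:E)%E.
  have := @measurable_fun_fubini_tonelli_F _ _ (measurableTypeR R) T R m (G j)
    (mG j) (G0 j).
  by rewrite /fubini_F; under eq_fun do rewrite FE.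
have F0 j s : (0 <= F j s)%E.
  by apply: integral_ge0 => x _; rewrite lee_fin steep_bump_ge0.
have intF j : (\int[lebesgue_measure]_(s in I) F j s <= m D)%E.
  have -> : (\int[lebesgue_measure]_(s in I) F j s =
             \int[lebesgue_measure]_s \int[m]_x G j (s, x))%E.
    rewrite [LHS]integral_mkcond; apply: eq_integral => s _;
      rewrite FE /patch indicE.
    by case: ifPn => _; rewrite ?mule1 ?mule0.
  rewrite (@fubini_tonelli _ _ (measurableTypeR R) T R lebesgue_measure m (G j)
    (mG j) (G0 j)).
  rewrite /fubini_G.
  apply: (@le_trans _ _ (\int[m]_x (\1_D x)%:E)%E); last first.
    by rewrite integral_indic// setIT.
  apply: ge0_le_integral => //.
  - by move=> x _; apply: integral_ge0 => s _; exact: G0.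
  - exact: measurable_fun_fubini_tonelli_G.
  - by apply/measurable_EFinP.
  - move=> x _; rewrite /G /= indicE; case: (x \in D); last first.
      by under eq_integral do rewrite mulr0; rewrite integral0.
    apply: le_trans (steep_bump_mass j S (y x) M0).
    rewrite [leRHS]integral_mkcond le_eqVlt; apply/orP; left; apply/eqP.
    apply: eq_integral => s _; rewrite mulr1 indicE /patch.
    by case: ifPn; rewrite ?mulr1 ?mulr0.
(* If no level were cheap infinitely often, the lower limit in [j] of the costs would be at least
   [eps] on all of [I], and Fatou's lemma would give [eps * M <= m D]. *)
apply: contrapT => H.
have low s : I s -> (eps%:E <= limn_einf (F ^~ s))%E.
  move=> Is; rewrite leNgt; apply/negP => lt; apply: H; exists s.
    by move: Is; rewrite /I /= in_itv/= => /andP[].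
  move=> n; have : (einfs (F ^~ s) n < eps%:E)%E.
    apply: le_lt_trans lt;
      rewrite limn_einf_lim (cvg_lim _ (@cvg_einfs_sup _ (F ^~ s)))//.
    by apply: ereal_sup_ubound; exists n.
  by move=> /ereal_inf_lt[_ [j nj <-] Fj]; exists j.
have mFI j : measurable_fun I (F j).
  apply: (eq_measurable_fun (fun s => F j s * (\1_I s)%:E)%E);
    last exact: measurable_funTS.
  by move=> s Is; rewrite indicE Is mule1.
have := @fatou _ (measurableTypeR R) R lebesgue_measure I mI F mFI (fun j s _
  => F0 j s).
have : (limn_einf (fun j => \int[lebesgue_measure]_(s in I) F j s) <= m D)%E.
  rewrite limn_einf_lim; apply: lime_le; first exact: is_cvg_einfs.
  apply: nearW => n; apply: le_trans (intF n).
  by apply: ereal_inf_lbound; exists n => /=.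
move=> h1 h2; have {h1 h2} := le_trans h2 h1.
have : (eps%:E * M%:E <= \int[lebesgue_measure]_(s in I) limn_einf (F^~ s))%E.
  have -> : (eps%:E * M%:E = \int[lebesgue_measure]_(s in I) (cst eps%:E) s)%E.
    rewrite integral_cst//; congr (_ * _)%E; apply/esym.
    apply: etrans (lebesgue_measure_itv `[S, (S + M)%R]) _ => /=.
    by rewrite lte_fin ltrDl M0 -EFinD addrAC subrr add0r.
  apply: ge0_le_integral => //.
  - by move=> s _; rewrite lee_fin ltW.
  - apply: measurableT_comp => //; apply: measurable_fun_limn_esup => k.
    exact: measurableT_comp.
move=> h1 h2; have {h1 h2} := le_trans h1 h2.
rewrite -(@fineK _ (m D)) ?ge0_fin_numE// -EFinM lee_fin /M mulrDr mulr1 mulrCA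
  mulfV ?gt_eqF// mulr1.
by lra.
Qed.
End cut_level.

End steep_sigmoid.

(** * Cutting a set by a half-space *)

Section cut.
Context {R : realType} {N : nat}.
Local Notation V := 'rV[R]_N.
Local Notation mu := (@borel_lebesgue_rV R N).
Local Notation leb := (@lebesgue_rV R N).
Local Notation carV := (caratheodory_type (mu^*)%mu).
Implicit Types (xi : V -> V) (C E : set V) (f : V -> R).

Lemma test_field_logistic C xi (b c : R) (i : 'I_N) : test_field C xi ->
  test_field C (fun x => logistic b c i x *: xi x).
Proof.
move=> [/smooth_coordP sxi cK KC xi1].
have supE : [set x | logistic b c i x *: xi x != 0] = [set x | xi x != 0].
  by apply/seteqP; split => x /=; rewrite scaler_eq0 negb_or gt_eqF ?logistic_gt0.
split; rewrite ?supE//.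
- apply/smooth_coordP => j.
  rewrite (_ : (fun y => _) = logistic b c i * (fun y => xi y ord0 j)).
    exact: smooth_logisticM.
  by apply/funext => y; rewrite mxE.
- move=> x; rewrite euclidean_normZ ?(ltW (logistic_gt0 _ _ _ _))//.
  rewrite mulr_ile1 ?(ltW (logistic_gt0 _ _ _ _)) ?(ltW (logistic_lt1 _ _ _ _))//.
  exact: sqrtr_ge0.
Qed.

Lemma divergence_logistic xi (b c : R) (i : 'I_N) x : smooth xi ->
  divergence (fun x => logistic b c i x *: xi x) x =
  logistic b c i x * divergence xi x -
  b * (logistic b c i x * (1 - logistic b c i x)) * xi x ord0 i.
Proof.
move=> /smooth_coordP sxi; rewrite /divergence mulr_sumr.
pose L := logistic b c i.
have E k : 'D_(base_vec k) (fun y => (L y *: xi y) ord0 k) x =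
    L x * 'D_(base_vec k) (fun y => xi y ord0 k) x -
    (i == k)%:R * (b * (L x * (1 - L x)) * xi x ord0 k).
  rewrite (_ : (fun y => _) = L * (fun y => xi y ord0 k)); last first.
    by apply/funext => y; rewrite mxE.
  have [dL] := logistic_derive b c i x k; rewrite -/L => LE.
  rewrite deriveM//; last exact: (sxi k [::]).2.
  by rewrite LE /GRing.scale/=; ring.
under eq_bigr do rewrite E.
rewrite big_split/=; congr (_ + _); rewrite sumrN; congr (- _).
rewrite (bigD1 i)//= eqxx mul1r big1 ?addr0// => k /negbTE.
by rewrite eq_sym => ->; rewrite mul0r.
Qed.

Lemma sigmoid_steep_cvg (s t : R) :
  sigmoid (steep j s t) @[j --> \oo] --> (((t <= s)%R)%:R : R).
Proof.
apply/cvgrPdist_lt => e e0.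
have ie := near_infty_natSinv_lt (PosNum e0).
have [ts|st] := leP t s.
  apply: filterS ie => j; apply: le_lt_trans.
  set u := steep j s t.
  have um : u <= - j.+1%:R.
    by rewrite /u /steep gerDr pmulr_rle0 ?subr_le0// exprn_gt0.
  (* Uses [1 + x <= expR x] at [x = - u], which is at least [j.+1] thanks to the shift in [steep],
     even when [t = s]. *)
  have Eu : (1 + j.+1%:R) * expR u <= 1.
    rewrite -[leRHS](expRxMexpNx_1 (- u)) opprK ler_pM2r ?expR_gt0//.
    by apply: le_trans (expR_ge1Dx _); rewrite lerD2l lerNr.
  have E0 := expR_gt0 u.
  rewrite ger0_norm ?subr_ge0 ?(ltW (sigmoid_lt1 _))//.
  rewrite (_ : 1%:R - sigmoid u = expR u / (1 + expR u)); last first.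
    by rewrite /sigmoid; field; lra.
  have m0 : 0 < j.+1%:R :> R by [].
  rewrite ler_pdivrMr; last by lra.
  rewrite -(ler_pM2l m0) mulrA mulfV ?gt_eqF// mul1r.
  by move: m0 Eu E0; set m := j.+1%:R; set E := expR u; rewrite mulrDl mul1r;
    set mE := m * E; lra.
(* Once [j.+1 * (t - s)] exceeds 2, the quadratic term outweighs the shift and [steep j s t] is at
   least [j.+1]. *)
have d0 : 0 < (t - s) / 2 by rewrite divr_gt0 ?subr_gt0.
near=> j.
have ij : j.+1%:R^-1 < e by near: j.
have dj : j.+1%:R^-1 < (t - s) / 2 by near: j;
  exact: (near_infty_natSinv_lt (PosNum d0)).
rewrite sub0r normrN gtr0_norm ?sigmoid_gt0//; apply: le_lt_trans ij.
have m0 : 0 < j.+1%:R :> R by [].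
have p0 : 0 < 1 + expR (steep j s t) by have := expR_gt0 (steep j s t); lra.
rewrite /sigmoid lef_pV2 ?posrE//.
have : j.+1%:R <= steep j s t.
  rewrite /steep; move: dj; rewrite -(ltr_pM2l m0) mulfV ?gt_eqF//.
  set m := j.+1%:R in m0 *; nra.
have := expR_ge1Dx (steep j s t); lra.
Unshelve. all: by end_near. Qed.

Variables (a : R) (i : 'I_N).
Let phi (j : nat) (s : R) : V -> R :=
  logistic (j.+1%:R ^+ 2 * a) (- (j.+1%:R ^+ 2 * s) - j.+1%:R) i.

Let phiE j s x : phi j s x = sigmoid (steep j s (a * x ord0 i)).
Proof. by rewrite /phi /logistic /steep; congr sigmoid; ring. Qed.

(** In the application [a] is [u ord0 i], so that [a * x ord0 i] increases along [u] whatever the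
    sign of [a]. *)
Definition lower_half (s : R) : set V := [set x | a * x ord0 i <= s].

Lemma lower_half_measurable s : lebesgue_measurable (lower_half s).
Proof.
apply: closed_lebesgue_measurable.
have -> : lower_half s = (fun x : V => a * x ord0 i) @^-1` [set t | t <= s] by [].
apply: closed_comp => [x _|]; last exact: closed_le.
by apply: continuous_cstM; exact: coord_continuous.
Qed.

(** The cutoff times a test field is a test field. By the product rule, the integral over [E] of the
    cutoff times [divergence xi] therefore exceeds the perimeter of [E] by at most [|a|] times the
    integral of the bump. Dominated convergence identifies the limit of these integrals. *)
Lemma cut_perimeter_le C E s (eps : R) : lebesgue_measurable E -> (leb E < +oo)%E ->
  0 <= eps ->
  (forall n, exists2 j, (n <= j)%N &
    (\int[leb]_(x in E) (steep_bump j s (a * x ord0 i))%:E < eps%:E)%E) ->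
  (perimeter C (E `&` lower_half s) <= perimeter C E + (`|a| * eps)%:E)%E.
Proof.
move=> mE Eoo e0 hj; apply: perimeter_le => xi txi.
have mEH : lebesgue_measurable (E `&` lower_half s).
  by apply: measurableI => //; exact: lower_half_measurable.
have [sxi cK KC xi1] := txi.
have xii : forall x, `|xi x ord0 i| <= 1.
  by move=> x; apply: le_trans (coord_le_euclidean _ _) (xi1 x).
have cphi j : continuous (phi j s) by move=> x;
  exact/differentiable_continuous/logistic_diff.
have mphi j : measurable_fun (setT
  : set carV) (phi j s) by exact: continuous_lebesgue_measurable.
have mdiv : measurable_fun (setT
  : set carV) (divergence xi) by exact: divergence_measurable txi.
have [M M0 divM] := divergence_bounded txi.
have phi0 j x : 0 < phi j s x by exact: logistic_gt0.
have phi1 j x : phi j s x < 1 by exact: logistic_lt1.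
pose A j := (\int[leb]_(x in E) (phi j s x * divergence xi x)%:E)%E.
have mA j : measurable_fun (setT : set carV) (fun x => phi j s x * divergence xi x).
  exact: measurable_funM.
have Acvg : A j @[j --> \oo] --> (\int[leb]_(x in E `&` lower_half s)
  (divergence xi x)%:E)%E.
  rewrite integral_mkcondr; apply: (@dominated_cvg _ carV R leb E mE
    (fun j x => (phi j s x * divergence xi x)%:E) _ (fun=> M%:E)).
  - by move=> j; apply/measurable_EFinP; exact: measurable_funTS.
  - move=> x _; rewrite (_
      : (_ \_ _) x = ((a * x ord0 i <= s)%R%:R * divergence xi x)%:E).
      apply: cvg_EFin; first exact: nearW.
      apply: cvgM; last exact: cvg_cst.
      by under eq_fun do rewrite phiE; exact: sigmoid_steep_cvg.
    rewrite /patch; case: ifPn => [/set_mem|/negP]; rewrite /lower_half /=.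
      by move=> ->; rewrite mul1r.
    by move=> H; rewrite (_ : (_ <= s) = false) ?mul0r//; apply/negP => as_;
      apply: H; exact/mem_set.
  - by [].
  - by apply: (@bounded_integrable _ _ _ (cst M) `|M|) => //; exact: measurable_cst.
  - move=> j x _; rewrite lee_fin normrM -[leRHS]mul1r ler_pM//.
    by rewrite ger0_norm ltW.
have Ale j : (\int[leb]_(x in E) (steep_bump j s (a * x ord0 i))%:E < eps%:E)%E ->
    (A j <= perimeter C E + (`|a| * eps)%:E)%E.
  move=> bj; pose xij x := phi j s x *: xi x.
  have txij : test_field C xij by exact: test_field_logistic.
  apply: le_trans (leeD2r _ (perimeter_ub E txij)).
  have mb : measurable_fun (setT : set carV) (fun x
    : V => steep_bump j s (a * x ord0 i)).
    apply: continuous_lebesgue_measurable => x.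
    apply: (@continuous_comp _ _ _ (fun x : V => a * x ord0 i) (steep_bump j s)).
      by apply: continuous_cstM; exact: coord_continuous.
    exact: steep_bump_continuous.
  have ib : leb.-integrable E (EFin \o (fun x
    : V => steep_bump j s (a * x ord0 i))).
    apply: (@bounded_integrable _ _ _ _ (j.+1%:R ^+ 2)) => // x.
    by rewrite ger0_norm ?steep_bump_ge0// steep_bump_le.
  have iab : leb.-integrable E (EFin \o (fun x
    : V => `|a| * steep_bump j s (a * x ord0 i))).
    rewrite (_ : _ \o _ = (fun x => `|a|%:E * (EFin \o (fun x
      : V => steep_bump j s (a * x ord0 i))) x)%E)//.
    exact: integrableZl.
  apply: (@le_trans _ _ (\int[leb]_(x in E) (divergence xij x)%:E +
      \int[leb]_(x in E) (`|a| * steep_bump j s (a * x ord0 i))%:E)%E); last first.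
    apply: leeD2l; under eq_integral do rewrite EFinM.
    rewrite integralZl// EFinM lee_wpmul2l//; exact: ltW.
  rewrite -integralD//; last exact: divergence_integrable txij _ _.
  apply: le_integral => //.
  - by apply: (@bounded_integrable _ _ _ _ M) => // x;
      rewrite normrM -[leRHS]mul1r ler_pM// ger0_norm ltW.
  - by apply: integrableD => //; exact: divergence_integrable txij _ _.
  move=> x _; rewrite -EFinD lee_fin divergence_logistic//.
  rewrite -/(phi j s x) /steep_bump -!phiE.
  have := xii x; rewrite ler_norml => /andP[x1 x2].
  have := phi0 j x; have := phi1 j x; set u := phi j s x;
    set z := xi x ord0 i in x1 x2 *.
  move=> u1 u0; set m2 := j.+1%:R ^+ 2.
  have w0 : 0 <= m2 * (u * (1 - u))
    by rewrite mulr_ge0 ?exprn_ge0// mulr_ge0 ?ltW ?subr_gt0.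
  rewrite (_ : m2 * a * (u * (1 - u)) * z = (m2 * (u * (1 - u))) * (a * z));
    last by ring.
  set W := m2 * _ in w0 *.
  have : a * z <= `|a|.
    by apply: le_trans (ler_norm _) _; rewrite normrM ler_piMr// ler_norml x1.
  by nra.
(* The bound is known for infinitely many [j] only; that is enough for the lower limit, which is the
   limit here. *)
rewrite -(cvg_limn_einf_sup Acvg).1 limn_einf_lim.
apply: lime_le; first exact: is_cvg_einfs.
apply: nearW => n; have [j nj /Ale] := hj n; apply: le_trans.
by apply: ereal_inf_lbound; exists j.
Qed.

Lemma cut_perimeter C E (S eps : R) : lebesgue_measurable E -> (leb E < +oo)%E ->
  0 < eps -> exists2 s, S <= s &
    (perimeter C (E `&` lower_half s) <= perimeter C E + (`|a| * eps)%:E)%E.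
Proof.
move=> mE Eoo e0.
have my : measurable_fun (setT : set carV) (fun x : V => a * x ord0 i).
  by apply: continuous_lebesgue_measurable; apply: continuous_cstM;
    exact: coord_continuous.
have [s Ss hs] := @cut_level R _ carV leb E _ mE Eoo my S eps e0.
by exists s => //; apply: cut_perimeter_le => //; exact: ltW.
Qed.

End cut.

(** * Recession directions and the asymptotic cone *)

Section recession.
Context {R : realType} {N : nat}.
Local Notation V := 'rV[R]_N.
Implicit Types (C : set V).

Lemma convex_set_comb C (x y : V) (l : R) : convex_set C -> C x -> C y ->
  0 <= l -> l <= 1 -> C (l *: x + (1 - l) *: y).
Proof.
move=> cC Cx Cy l0 l1; have := cC x y (Itv01 l0 l1) (mem_set Cx) (mem_set Cy).
by move/set_mem.
Qed.

Definition recession C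
  : set V := [set w | forall y t, C y -> 0 <= t -> C (y + t *: w)].

Lemma asymptotic_cone_ray C p w t
  : asymptotic_cone C p w -> 0 < t -> C (p + t *: w).
Proof.
move=> aw t0; have [|x Cx <-] := aw t^-1; first by rewrite /= invr_gt0.
by rewrite scalerA mulfV ?gt_eqF// scale1r addrC subrK.
Qed.

(** Points ever farther on the ray from [p], averaged with [y] with weight [1 / k.+1], stay in [C]
    by convexity and converge to [y + t *: w]; closedness concludes. *)
Lemma asymptotic_cone_recession C p : closed C -> convex_set C ->
  asymptotic_cone C p `<=` recession C.
Proof.
move=> clC cC w aw y t Cy; rewrite le_eqVlt => /predU1P[<-|t0].
  by rewrite scale0r addr0.
pose u (k : nat) : V := y + t *: w + k.+1%:R^-1 *: (p - y).
apply: (@closed_cvg _ _ \oo _ u C clC).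
  apply: nearW => k; have k0 : 0 < k.+1%:R :> R by [].
  rewrite (_ : u k = k.+1%:R^-1 *: (p + (k.+1%:R * t) *: w) + (1 - k.+1%:R^-1)
    *: y).
    apply: convex_set_comb => //; last by rewrite invf_le1// ler1n.
    by apply: asymptotic_cone_ray => //; rewrite mulr_gt0.
  have kn0 : k.+1%:R != 0 :> R by rewrite gt_eqF.
  by apply/rowP => i; rewrite /u !mxE; move: kn0; set m := k.+1%:R => kn0; field.
rewrite -[X in _ --> X]addr0 /u; apply: cvgD; first exact: cvg_cst.
rewrite -[X in _ --> X](scale0r (p - y)); apply: cvgZr_tmp.
have H := @cvg_harmonic R; exact: H.
Qed.

Lemma recessionD C w1 w2
  : recession C w1 -> recession C w2 -> recession C (w1 + w2).
Proof. by move=> h1 h2 y t Cy t0; rewrite scalerDr addrA; apply: h2 => //;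
  exact: h1. Qed.

Lemma recessionZ C w a : 0 <= a -> recession C w -> recession C (a *: w).
Proof. by move=> a0 h y t Cy t0; rewrite scalerA; apply: h => //;
  rewrite mulr_ge0. Qed.

Lemma recession0 C : recession C 0.
Proof. by move=> y t Cy _; rewrite scaler0 addr0. Qed.

Lemma affine_dim_full (S : set V) : affine_dim S = N -> (0 < N)%N ->
  exists q (s : N.-tuple V), [/\ S q, (forall i,
    S (tnth s i)) & free [seq x - q | x <- s]].
Proof.
move=> dS N0; apply: contrapT => H; suff : (affine_dim S <= N.-1)%N.
  by rewrite dS leqNgt prednK ?leqnn.
apply/bigmax_leqP => d /asboolP [q [s hs]].
rewrite -ltnS prednK// ltn_neqAle -ltnS ltn_ord andbT.
apply/negP => /eqP dN; apply: H; exists q; move: s hs; rewrite dN => s hs.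
by exists s.
Qed.

(** [u] is the barycentre of a full-dimensional simplex in the cone; a small perturbation keeps all
    its barycentric weights nonnegative. *)
Lemma recession_ball C p : closed C -> convex_set C -> (0 < N)%N ->
  affine_dim (asymptotic_cone C p) = N ->
  exists (u : V) (c : R), 0 < c /\ forall b : V, `|b| <= c -> recession C (u + b).
Proof.
move=> clC cC N0 /affine_dim_full[//|q [s [aq as_ fr]]].
have sub := asymptotic_cone_recession clC cC (p := p).
pose X := [tuple of [seq x - q | x <- s]].
have bX : basis_of fullv X.
  rewrite basisEfree fr subvf/= dimvf size_tuple.
  by rewrite dim_matrix mul1r.
pose k0 := \sum_(i < N) \sum_(j < N) `|coord X i (delta_mx ord0 j)|.
have k00 : 0 <= k0 by apply: sumr_ge0 => i _; apply: sumr_ge0 => j _.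
have coord_le i (b : V) : `|coord X i b| <= k0 * `|b|.
  rewrite {1}(row_sum_delta b) linear_sum /=;
    apply: le_trans (ler_norm_sum _ _ _) _.
  apply: (@le_trans _ _ (\sum_(j < N) `|b| * `|coord X i (delta_mx ord0 j)|)).
    apply: ler_sum => j _; rewrite linearZ/= normrM ler_wpM2r//.
    exact: rV_le_norm.
  rewrite -mulr_sumr mulrC ler_wpM2r//.
  rewrite /k0 [leRHS](bigD1 i)//= lerDl; apply: sumr_ge0 => ? _; exact: sumr_ge0.
pose n1 : R := N.+1%:R.
have n10 : 0 < n1 by [].
(* Then [|b| <= c] bounds each coordinate of [b] in the basis [X] by [n1^-1 ^+ 2]: too small to make
   a weight [n1^-1] negative, or to push the sum of the [N] weights above 1. *)
pose c := ((k0 + 1) * n1 ^+ 2)^-1.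
have c0 : 0 < c by rewrite invr_gt0 mulr_gt0 ?exprn_gt0// ltr_wpDl.
exists (q + \sum_(i < N) n1^-1 *: X`_i), c; split => // b bc.
have cb i : `|coord X i b| <= n1^-1 ^+ 2.
  apply: le_trans (coord_le i b) _.
  apply: (@le_trans _ _ ((k0 + 1) * c)).
    by apply: ler_pM => //; rewrite lerDl.
  by rewrite /c invfM mulrA mulfV ?mul1r ?exprVn// gt_eqF// ltr_wpDl.
pose al i := n1^-1 + coord X i b.
have al0 i : 0 <= al i.
  rewrite /al; have := cb i; rewrite ler_norml => /andP[h _].
  have : n1^-1 ^+ 2 <= n1^-1.
    by rewrite expr2 ler_piMl ?invr_ge0 ?(ltW n10)// invf_le1// ler1n.
  by move: h; set z := _ ^+ 2; set w := n1^-1; lra.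
have al1 : \sum_(i < N) al i <= 1.
  apply: (@le_trans _ _ (\sum_(i < N) (n1^-1 + n1^-1 ^+ 2))).
    by apply: ler_sum => i _; rewrite lerD2l; apply: le_trans (ler_norm _) (cb i).
  rewrite sumr_const card_ord -mulr_natl.
  have -> : N%:R = n1 - 1 by rewrite /n1 -natr1 addrK.
  rewrite (_ : (n1 - 1) * (n1^-1 + n1^-1 ^+ 2) = 1 - n1^-1 ^+ 2);
    last by field; lra.
  by rewrite gerBl exprn_ge0// invr_ge0 ltW.
have XE (i : 'I_N) : X`_i = tnth s i - q
  by rewrite (nth_map 0) ?size_tuple// (tnth_nth 0).
have -> : q + \sum_(i < N) n1^-1 *: X`_i + b =
    (1 - \sum_(i < N) al i) *: q + \sum_(i < N) al i *: tnth s i.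
  rewrite {1}(coord_basis bX (memvf b)) -addrA -big_split/= scalerBl scale1r.
  rewrite -addrA; congr (_ + _); rewrite scaler_suml -sumrN -big_split/=.
  apply: eq_bigr => i _; rewrite -scalerDl -/(al i) XE scalerBr addrC.
  by [].
apply: recessionD.
  by apply: recessionZ; [rewrite subr_ge0|exact: sub].
elim/big_ind : _ => [|x y|i _]; first exact: recession0.
  exact: recessionD.
by apply: recessionZ => //; exact: sub.
Qed.

(** With a nonzero coordinate of [u], coordinate half-spaces can separate off the far part of the
    body. Half of the radius is spent on tilting [u], half is kept. *)
Lemma recession_ball_coord C (i : 'I_N) (u : V) (c : R) : 0 < c ->
  (forall b : V, `|b| <= c -> recession C (u + b)) ->
  exists (u' : V) (c' : R), [/\ u' ord0 i != 0, 0 < c' &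
    forall b : V, `|b| <= c' -> recession C (u' + b)].
Proof.
move=> c0 h; have [u0|u0] := eqVneq (u ord0 i) 0; last by exists u, c.
have en : `|delta_mx ord0 i : V| <= 1.
  by apply: rV_norm_le => // j; rewrite mxE; case: (_ && _);
    rewrite ?normr1 ?normr0.
exists (u + (c / 2) *: delta_mx ord0 i), (c / 2); split.
- by rewrite !mxE u0 add0r !eqxx/= mulr1 gt_eqF// divr_gt0.
- by rewrite divr_gt0.
move=> b bc; rewrite -addrA; apply: h; apply: le_trans (ler_normD _ _) _.
rewrite normrZ (@ger0_norm _ (c / 2)) ?divr_ge0 ?(ltW c0)//.
have h1 : c / 2 * `|delta_mx ord0 i
  : V| <= c / 2 by rewrite ler_piMr// divr_ge0// ltW.
by apply: le_trans (lerD h1 bc) _; lra.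
Qed.

(** From a point [x - t *: u] far enough back, any [z] lies in a direction within [c] of [u]. *)
Lemma recession_no_line C (u : V) (c : R) : 0 < c ->
  (forall b : V, `|b| <= c -> recession C (u + b)) ->
  forall x, (forall t, 0 < t -> C (x - t *: u)) -> C = setT.
Proof.
move=> c0 h x hx; apply/seteqP; split => // z _.
pose t := `|z - x| / c + 1; have t0 : 0 < t by rewrite ltr_wpDl// divr_ge0// ltW.
have hb : `|t^-1 *: (z - x)| <= c.
  rewrite normrZ gtr0_norm ?invr_gt0// ler_pdivrMl// /t mulrDl mulfVK ?gt_eqF//.
  by rewrite mul1r lerDl ltW.
have := h _ hb _ t (hx t t0) (ltW t0).
have -> // : x - t *: u + t *: (u + t^-1 *: (z - x)) = z.
by apply/rowP => i; rewrite !mxE; field; rewrite gt_eqF.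
Qed.

Lemma cube_in_cone C p (i : 'I_N) (u : V) (c : R) : 0 < c -> C p -> u ord0 i != 0 ->
  (forall b : V, `|b| <= c -> recession C (u + b)) ->
  forall r s : R, 0 < r -> exists l,
    cube l r `<=` C `&` ~` lower_half (u ord0 i) i s.
Proof.
move=> c0 Cp u0 h r s r0; set a := u ord0 i in u0 *.
have a2 : 0 < a ^+ 2 by rewrite exprn_even_gt0.
(* The first summand is large enough for a cube of side [r] at [p + t *: u] to fit in [p] plus the
   cone around [u]; the second pushes [a * x ord0 i] above [s], since it grows like [t * a ^+ 2]. *)
pose t := r / c + (`|s| + `|a * p ord0 i| + `|a| * r + 1) / a ^+ 2.
have t0 : 0 < t.
  by rewrite ltr_wpDl ?divr_ge0 ?(ltW r0) ?(ltW c0)// divr_gt0// ltr_wpDl//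
    !addr_ge0// mulr_ge0// ltW.
exists (fun j => (p + t *: u) ord0 j) => x xl.
pose d := x - (p + t *: u).
have d0 j : 0 <= d ord0 j < r by have := xl j; rewrite /d !mxE; lra.
have xE : x = p + t *: (u + t^-1 *: d).
  by apply/rowP => j; rewrite /d !mxE; field; rewrite gt_eqF.
split.
  rewrite xE; apply: h => //; last exact: ltW.
  rewrite normrZ gtr0_norm ?invr_gt0// ler_pdivrMl//.
  apply: (@le_trans _ _ r).
    apply: rV_norm_le => [|j]; first exact: ltW.
    by have /andP[d1 /ltW d2] := d0 j; rewrite ger0_norm.
  rewrite -ler_pdivrMr// /t lerDl divr_ge0 ?(ltW a2)// !addr_ge0// mulr_ge0//;
    exact: ltW.
rewrite /lower_half /=; apply/negP; rewrite -ltNge.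
rewrite (_ : x ord0 i = p ord0 i + t * a + d ord0 i); last first.
  by rewrite /d !mxE /a; ring.
have -> : a * (p ord0 i + t * a + d ord0 i) = a * p ord0 i + t * a ^+ 2 + a * d
  ord0 i by ring.
have : `|a * d ord0 i| <= `|a| * r.
  have /andP[d1 d2] := d0 i; rewrite normrM ler_wpM2l//; rewrite ger0_norm// ltW//.
have : `|s| + `|a * p ord0 i| + `|a| * r + 1 <= t * a ^+ 2.
  rewrite -ler_pdivrMr// /t lerDr divr_ge0//; exact: ltW.
rewrite ler_norml => h1 /andP[h2 _].
have := ler_norm s; have := lerNnormlW (lexx `|a * p ord0 i|).
lra.
Qed.

End recession.

(** * Bounds on limits of extended real sequences *)

Section ereal_limits.
Context {R : realType}.
Implicit Types (u : nat -> \bar R) (l c : \bar R).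

Lemma ecvg_ge u l c : u @ \oo --> l -> (forall n, c <= u n)%E -> (c <= l)%E.
Proof.
move=> ul cu; rewrite -(cvg_lim _ ul)//; apply: lime_ge; last exact: nearW.
by apply/cvg_ex; exists l.
Qed.

Lemma ecvg_le u l c : u @ \oo --> l -> (forall n, u n <= c)%E -> (l <= c)%E.
Proof.
move=> ul cu; rewrite -(cvg_lim _ ul)//; apply: lime_le; last exact: nearW.
by apply/cvg_ex; exists l.
Qed.

End ereal_limits.

(** * Sweeping out a set by translates of the body *)

Section sweep.
Context {R : realType} {N : nat}.
Local Notation V := 'rV[R]_N.
Local Notation mu := (@borel_lebesgue_rV R N).
Local Notation leb := (@lebesgue_rV R N).
Local Notation carV := (caratheodory_type (mu^*)%mu).
Implicit Types (C E A B : set V).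

Lemma le_lebesgue_rV A B : lebesgue_measurable A -> lebesgue_measurable B ->
  A `<=` B -> (leb A <= leb B)%E.
Proof. by move=> mA mB AB; apply: le_measure => //; rewrite inE. Qed.

Lemma lebesgue_rV_translate A (w : V) :
  leb ((fun x : V => 1 *: x + w) @^-1` A) = leb A.
Proof. by rewrite -[RHS](@lebesgue_rV_affine _ _ 1 w A ltr01) expr1n mul1e. Qed.

Lemma centered_box_cover : \bigcup_m box (fun=> - m%:R) (fun=> m%:R) = [set: V].
Proof.
apply/seteqP; split => // x _.
have [m xm] : exists m : nat, `|x| < m%:R.
  by exists (Num.truncn `|x|).+1; exact: truncnS_gt.
exists m => // i; have := le_lt_trans (rV_le_norm x i) xm.
by rewrite ltr_norml => /andP[/ltW -> ->].
Qed.

(** Each line parallel to [u] meets [A] at most once, so distinct translates along [u] are disjoint.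
    Infinitely many translates of a bounded piece of [A], all of the same volume, fit in one bounded
    box; hence the piece is null. *)
Lemma thin_null A (u : V) : lebesgue_measurable A ->
  (forall x s, A x -> 0 < s -> ~ A (x + s *: u)) -> leb A = 0%E.
Proof.
move=> mA thin.
pose bx m : set V := box (fun=> - m%:R) (fun=> m%:R).
have mbx m : lebesgue_measurable (bx m) by exact: box_measurable.
have mAb m : lebesgue_measurable (A `&` bx m)
  by exact: (measurableI _ _ mA (mbx m)).
have Ab0 m : leb (A `&` bx m) = 0%E.
  pose M : R := m%:R + `|u|.
  pose Z : set V := box (fun=> - M) (fun=> M).
  have M0 : 0 <= M by rewrite addr_ge0.
  have mZ : lebesgue_measurable Z by exact: box_measurable.
  have Zoo : (leb Z < +oo)%E by rewrite box_volume ?ltry// => i; lra.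
  pose F (j : nat) : set V := (fun x
    : V => 1 *: x + j.+1%:R^-1 *: u) @^-1` (A `&` bx m).
  have mF j : lebesgue_measurable (F j) by exact: lebesgue_measurable_affine.
  have FZ j : F j `<=` Z.
    move=> x [_ xb] i; have := xb i; rewrite !mxE mul1r.
    have : `|j.+1%:R^-1 * u ord0 i| <= `|u|.
      rewrite normrM ger0_norm ?invr_ge0//; apply: le_trans (rV_le_norm u i).
      by rewrite ler_piMl// invf_le1// ler1n.
    by rewrite ler_norml /M; set z := _ * _; lra.
  have tF : trivIset setT F.
    move=> i j _ _ [x [[Fi _] [Fj _]]]; apply: contrapT => /eqP ij.
    wlog ij' : i j Fi Fj ij / (i < j)%N.
      move=> H; move: (ij); rewrite neq_ltn => /orP[ij'|ji]; first exact: (H i j).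
      by apply: (H j i) => //; rewrite eq_sym.
    have ij0 : 0 < i.+1%:R^-1 - j.+1%:R^-1 :> R.
      by rewrite subr_gt0 ltf_pV2 ?posrE// ltr_nat.
    apply: (thin _ _ Fj ij0).
    have -> // : 1 *: x + j.+1%:R^-1 *: u + (i.+1%:R^-1 - j.+1%:R^-1) *: u =
        1 *: x + i.+1%:R^-1 *: u.
    by apply/rowP => k; rewrite !mxE; ring.
  have FA j : leb (F j) = leb (A `&` bx m) by exact: lebesgue_rV_translate.
  have Aoo : (leb (A `&` bx m) < +oo)%E.
    by rewrite -(FA 0%N); apply: le_lt_trans Zoo; exact: le_lebesgue_rV.
  have sumF k : (\sum_(i < k) leb (A `&` bx m) <= leb Z)%E.
    have := @measure_bigsetU _ _ _ leb F mF tF k.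
    rewrite (eq_bigr (fun=> leb (A `&` bx m))); last by move=> i _; exact: FA.
    move=> <-.
    apply: le_lebesgue_rV => //; first by apply: bigsetU_measurable => j _;
      exact: mF.
    by rewrite -bigcup_mkord => x [j _ /FZ].
  have : (0 <= leb (A `&` bx m))%E by exact: measure_ge0.
  move: Aoo sumF; case: (leb (A `&` bx m)) => // r _ sumF; rewrite lee_fin => r0.
  apply/eqP; rewrite eqe eq_le r0 andbT leNgt; apply/negP => rp.
  move: Zoo sumF; have : (0 <= leb Z)%E by exact: measure_ge0.
  case: (leb Z) => // z _ _ sumF.
  (* This many disjoint copies of volume [r] would already exceed the volume [z] of the box. *)
  have := sumF (Num.truncn (z / r)).+1.
  rewrite sumEFin sumr_const card_ord lee_fin -mulr_natl -ler_pdivlMr// leNgt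
    => /negP; apply.
  exact: truncnS_gt.
have := @nondecreasing_cvg_mu _ _ _ leb (fun m => A `&` bx m) mAb.
rewrite -setI_bigcupr centered_box_cover setIT => /(_ mA) h.
have /h : nondecreasing_seq (fun m => A `&` bx m).
  move=> m k mk; apply/subsetPset; apply: setIS => x xm i; have := xm i.
  have : m%:R <= k%:R :> R by rewrite ler_nat.
  lra.
rewrite (_ : _ \o _ = cst 0%E); last by apply/funext.
by move=> c0; have := cvg_unique _ c0 (cvg_cst 0%E); exact.
Qed.

Section shift_family.
Variables (C E : set V) (u : V).
Hypothesis clC : closed C.
Hypothesis uC : forall y t, C y -> 0 <= t -> C (y + t *: u).
Hypothesis empty : forall x, exists2 t, 0 < t & ~ C (x - t *: u).
Hypothesis mE : lebesgue_measurable E.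
Hypothesis Eoo : (leb E < +oo)%E.
Hypothesis EC : E `<=` C.

Let D (t : R) : set V := [set y | C (y - t *: u)].

Let D_le s t : s <= t -> D t `<=` D s.
Proof.
move=> st y; rewrite /D /= => Cy; have := uC Cy (t := t - s);
  rewrite subr_ge0 => /(_ st).
by rewrite scalerBl addrA subrK.
Qed.

Let D_closed t : closed (D t).
Proof.
rewrite (_ : D t = (fun y : V => 1 *: y + - (t *: u)) @^-1` C); last first.
  by apply/seteqP; split => y; rewrite /D /= scale1r.
by apply: closed_comp => // x _; exact: continuous_affine.
Qed.

Let mD t : lebesgue_measurable (D t).
Proof. exact/closed_lebesgue_measurable/D_closed. Qed.

Let mED t : lebesgue_measurable (E `&` D t).
Proof. exact: (measurableI _ _ mE (mD t)). Qed.

Let g t := leb (E `&` D t).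

Let g_le s t : s <= t -> (g t <= g s)%E.
Proof. by move=> st; apply: le_lebesgue_rV => //; apply: setIS; exact: D_le. Qed.

Let gE_lty t : (g t < +oo)%E.
Proof. by apply: le_lt_trans Eoo; apply: le_lebesgue_rV => //; exact: subIsetl. Qed.

Let D_bigcap t (s : nat -> R)
  : s k @[k --> \oo] --> t -> \bigcap_k D (s k) `<=` D t.
Proof.
move=> st y Dy; rewrite /D /=.
apply: (@closed_cvg _ _ \oo _ (fun k => y - s k *: u) C clC).
  by apply: nearW => k; exact: Dy.
apply: cvgB; first exact: cvg_cst.
by apply: cvgZr_tmp; exact: st.
Qed.

(** If [x] lies in [D t], then [x + s *: u] lies in [D (t + s)], hence in the union for [s > 0]; so
    the difference is thin along [u]. *)
Let leb_frontier t : leb (D t `\` \bigcup_k D (t + k.+1%:R^-1)) = 0%E.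
Proof.
apply: (@thin_null _ u).
  apply: measurableD; first exact: mD.
  by apply: (@bigcupT_measurable _ carV) => k; exact: mD.
move=> x s [Dx _] s0 [_]; apply.
have [k ks] : exists k : nat, k.+1%:R^-1 < s.
  by have [k] := @ltr_add_invr _ 0 s s0; rewrite add0r; exists k.
exists k => //; apply: (@D_le _ (t + s)); first by rewrite lerD2l ltW.
have -> // : D (t + s) (x + s *: u) = D t x.
rewrite /D /=; congr C.
by apply/rowP => i; rewrite !mxE; ring.
Qed.

(** The volume of [E] inside [D t] is nonincreasing in [t], continuous from the left as [C] is
    closed and from the right by [leb_frontier], and tends to 0 as [empty] expels every point. The
    witness is the supremum of the times at which it is at least [v]. *)
Lemma sweep_volume (v : R) : 0 < v -> (v%:E <= leb E)%E ->
  exists2 t, 0 <= t & leb (E `&` [set y | C (y - t *: u)]) = v%:E.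
Proof.
move=> v0 vE.
pose A := [set t | 0 <= t /\ (v%:E <= g t)%E].
have A0 : A 0.
  split=> //; rewrite /g setIidl// => y /EC; by rewrite /D /= scale0r subr0.
have [n gn] : exists n : nat, (g n%:R < v%:E)%E.
  apply: contrapT => H.
  have := @nonincreasing_cvg_mu _ _ _ leb (fun n =>
    E `&` D n%:R) (gE_lty _) (fun n => mED _).
  have -> : \bigcap_n (E `&` D n%:R) = set0.
    apply/seteqP; split => // x xD; have [t t0] := empty x; apply.
    have tn : t <= (Num.truncn t).+1%:R by rewrite ltW// truncnS_gt.
    by apply: (D_le tn); have [] := xD (Num.truncn t).+1 I.
  move=> /(_ (@measurable0 _ _)) h.
  have /h c0 : nonincreasing_seq (fun n => E `&` D n%:R).
    by move=> m k mk; apply/subsetPset; apply: setIS; apply: D_le; rewrite ler_nat.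
  have : (v%:E <= leb set0)%E.
    by apply: (ecvg_ge c0) => m; rewrite leNgt; apply/negP => gm; apply: H;
      exists m.
  have -> : leb set0 = 0%E by exact: measure0.
  by rewrite lee_fin leNgt v0.
have An t : A t -> t <= n%:R.
  by move=> [t0 vg]; rewrite leNgt; apply/negP => /ltW/g_le/(le_trans vg);
    rewrite leNgt gn.
have supA : has_sup A by split; [exists 0|exists n%:R => t /An].
pose ts := sup A.
have ts0 : 0 <= ts by apply: sup_upper_bound.
have above t : ts < t -> (g t < v%:E)%E.
  move=> tst; rewrite ltNge; apply/negP => vg; suff : t <= ts by rewrite leNgt tst.
  by apply: sup_upper_bound => //; split => //; exact: le_trans ts0 (ltW tst).
exists ts => //; apply/eqP; rewrite eq_le; apply/andP; split.
- pose U := \bigcup_k D (ts + k.+1%:R^-1).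
  have mU : lebesgue_measurable U by apply: (@bigcupT_measurable _ carV) => k;
    exact: mD.
  have EU : (leb (E `&` U) <= v%:E)%E.
    have := @nondecreasing_cvg_mu _ _ _ leb (fun k =>
      E `&` D (ts + k.+1%:R^-1)) (fun k => mED _).
    rewrite -setI_bigcupr -/U => /(_ (measurableI _ _ mE mU)) h.
    have /h c0 : nondecreasing_seq (fun k => E `&` D (ts + k.+1%:R^-1)).
      move=> m k mk; apply/subsetPset; apply: setIS; apply: D_le.
      by rewrite lerD2l lef_pV2 ?posrE// ler_nat.
    by apply: (ecvg_le c0) => k; apply/ltW/above; rewrite ltrDl invr_gt0.
  apply: (@le_trans _ _ (leb ((E `&` U) `|` (D ts `\` U)))).
    apply: le_lebesgue_rV; first exact: mED.
      by apply: (@measurableU _ carV);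
        [exact: (measurableI _ _ mE mU)|exact: (measurableD (mD _) mU)].
    by move=> x [Ex Dx]; have [Ux|Ux] := pselect (U x); [left|right].
  have := measureU2 leb (measurableI _ _ mE mU) (measurableD (mD ts) mU).
  move=> /le_trans; apply; rewrite -[leRHS]adde0; apply: leeD => //.
  by rewrite le_eqVlt; apply/orP; left; apply/eqP; exact: (leb_frontier ts).
(* Times below [ts], where the volume is still at least [v]; when [ts = 0] they are all 0, which
   belongs to [A]. *)
- pose s k := ts * (1 - k.+1%:R^-1).
  have sts : s k @[k --> \oo] --> ts.
    have e : ts = ts * (1 - 0) by rewrite subr0 mulr1.
    rewrite [X in _ --> X]e /s.
    apply: cvgM; first exact: cvg_cst; apply: cvgB; first exact: cvg_cst.
    exact: cvg_harmonic.
  have gs k : (v%:E <= g (s k))%E.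
    move: ts0; rewrite le_eqVlt => /predU1P[ts0|ts0].
      by rewrite /s -ts0 mul0r; case: A0.
    have : s k < sup A by rewrite /s -/ts gtr_pMr// gtrBl invr_gt0.
    by move=> /(sup_gt supA.1)[t [t0 vg]] /ltW /g_le; exact: le_trans.
  have := @nonincreasing_cvg_mu _ _ _ leb (fun k =>
    E `&` D (s k)) (gE_lty _) (fun n => mED _).
  have mcap : lebesgue_measurable (\bigcap_k (E `&` D (s k))).
    by apply: (@bigcapT_measurable _ carV) => k; exact: mED.
  move=> /(_ mcap) h.
  have /h c0 : nonincreasing_seq (fun k => E `&` D (s k)).
    move=> m k mk; apply/subsetPset; apply: setIS; apply: D_le.
    by rewrite /s ler_wpM2l// lerD2l lerN2 lef_pV2 ?posrE// ler_nat.
  apply: (@le_trans _ _ (leb (\bigcap_k (E `&` D (s k))))).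
    exact: (ecvg_ge c0).
  apply: le_lebesgue_rV => //; first exact: mED.
  move=> x xD; split; first by have [] := xD 0%N I.
  by apply: (D_bigcap sts) => k _; have [] := xD k I.
Qed.
End shift_family.

End sweep.

Lemma positive_root {R : realType} (N : nat) (x : R) : (0 < N)%N -> 0 < x ->
  exists2 r, 0 < r & r ^+ N = x.
Proof.
move=> N0 x0; exists (x `^ N%:R^-1); first exact: powR_gt0.
rewrite -powR_mulrn ?powR_ge0// -powRrM mulVf ?powRr1 ?(ltW x0)//.
by rewrite pnatr_eq0 -lt0n.
Qed.

(** * Comparing competitors, and continuity of the profile *)

Section profile.
Context {R : realType} {N : nat}.
Local Notation V := 'rV[R]_N.
Local Notation leb := (@lebesgue_rV R N).
Implicit Types (E : set V).
Variables (C : set V) (p u : V) (c : R) (i : 'I_N).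
Hypothesis N1 : (1 < N)%N.
Hypothesis clC : closed C.
Hypothesis Cp : C p.
Hypothesis c0 : 0 < c.
Hypothesis ui : u ord0 i != 0.
Hypothesis uc : forall b : V, `|b| <= c -> recession C (u + b).

Let N0 : (0 < N)%N. Proof. exact: ltn_trans N1. Qed.

Let a := u ord0 i.

Let mC : lebesgue_measurable C. Proof. exact: closed_lebesgue_measurable. Qed.

Definition competitor (v : R) : set (set V) :=
  [set E | [/\ lebesgue_measurable E, E `<=` C & leb E = v%:E]].

(** The whole space needs its own argument because translating it removes nothing; for any other
    [C], [recession_no_line] supplies the hypothesis [empty] of the sweep. *)
Lemma shrink E (v w : R) : 0 < w -> w <= v -> competitor v E ->
  exists2 F, competitor w F & (perimeter C F <= perimeter C E)%E.
Proof.
move=> w0 wv [mE EC vE].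
have Eoo : (leb E < +oo)%E by rewrite vE ltry.
have [CT|CT] := pselect (C = setT).
  have [b b0 bN] : exists2 b : R, 0 < b & b ^+ N = v / w.
    by apply: positive_root => //; rewrite divr_gt0//; exact: lt_le_trans w0 wv.
  have b1 : 1 <= b.
    by rewrite -(@ler_pXn2r _ N) ?nnegrE ?(ltW b0)// expr1n bN ler_pdivlMr// mul1r.
  have TC (x : V) : C x -> C (b *: x + 0) by rewrite CT.
  exists (affine_trace C b 0 E); last exact: perimeter_affine.
  split; first exact: affine_trace_measurable.
    by rewrite affine_traceE; exact: subIsetl.
  have := affine_trace_volume C 0 b0 E.
  rewrite (_ : E `&` _ = E); last first.
    apply/setIidPl => x _; exists (b^-1 *: x); first by rewrite CT.
    by rewrite scalerA mulfV ?gt_eqF// scale1r addr0.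
  rewrite vE bN; case: (leb _) => [z||]; last 2 first.
  - by rewrite gt0_muley// lte_fin divr_gt0//; exact: lt_le_trans w0 wv.
  - by rewrite gt0_muleNy// lte_fin divr_gt0//; exact: lt_le_trans w0 wv.
  move=> [zE]; congr EFin; have v0 := lt_le_trans w0 wv.
  apply: (@mulfI _ (v / w)); first by rewrite gt_eqF ?divr_gt0.
  by rewrite zE mulfVK// gt_eqF.
have uC y t : C y -> 0 <= t -> C (y + t *: u).
  by move=> Cy t0; have := uc (b := 0); rewrite normr0 addr0 => /(_ (ltW c0));
    apply.
have empty x : exists2 t, 0 < t & ~ C (x - t *: u).
  apply: contrapT => H; apply: CT;
    apply: (recession_no_line c0 uc (x := x)) => t t0.
  by apply: contrapT => Cx; apply: H; exists t.
have [|t t0 Et] := sweep_volume clC uC empty mE Eoo EC w0;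
  first by rewrite vE lee_fin.
have TC (x : V) : C x -> C (1 *: x + t *: u) by rewrite scale1r => Cx; exact: uC.
exists (affine_trace C 1 (t *: u) E); last exact: perimeter_affine.
split; first exact: affine_trace_measurable.
  by rewrite affine_traceE; exact: subIsetl.
have := affine_trace_volume C (t *: u) ltr01 E; rewrite expr1n mul1e => ->.
rewrite -Et; congr (leb (E `&` _)); apply/seteqP; split => [_ [x Cx <-]|y Cy].
  by rewrite /= scale1r addrK.
by exists (y - t *: u) => //; rewrite scale1r subrK.
Qed.

Lemma lower_half_exhaust E (d : R)
  : lebesgue_measurable E -> (leb E < +oo)%E -> 0 < d ->
  exists S, forall s, S <= s -> (leb E - d%:E <= leb (E `&` lower_half a i s))%E.
Proof.
move=> mE Eoo d0.
pose F k := E `&` lower_half a i k%:R.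
have mEH s : lebesgue_measurable (E `&` lower_half a i s).
  exact: (measurableI _ _ mE (lower_half_measurable a i s)).
have lhS s t : s <= t -> lower_half a i s `<=` lower_half a i t.
  by move=> st x /le_trans; apply.
have := @nondecreasing_cvg_mu _ _ _ leb F (fun k => mEH k%:R).
have -> : \bigcup_k F k = E.
  rewrite -setI_bigcupr; apply/setIidPl => x _.
  exists (Num.truncn (a * x ord0 i)).+1 => //=; rewrite /lower_half /=.
  by rewrite ltW// truncnS_gt.
move=> /(_ mE) h.
have /h c1 : nondecreasing_seq F.
  by move=> m k mk; apply/subsetPset; apply: setIS; apply: lhS; rewrite ler_nat.
have [k Fk] : exists k, (leb E - d%:E <= leb (F k))%E.
  apply: contrapT => H; have : (leb E <= leb E - d%:E)%E.
    by apply: (ecvg_le c1) => k; rewrite leNgt; apply/negP => /ltW Fk;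
      apply: H; exists k.
  have : (0 <= leb E)%E by exact: measure_ge0.
  by case: (leb E) Eoo => // e _ _; rewrite -EFinB lee_fin; lra.
exists k%:R => s ks; apply: le_trans Fk _; apply: (le_lebesgue_rV (mEH _) (mEH _)).
by apply: setIS; exact: lhS.
Qed.

Lemma grow E (v d rho eps : R) : 0 < v -> 0 < d -> 0 < rho -> 0 < eps ->
  d + d <= rho ^+ N -> competitor v E ->
  exists2 F, competitor (v + d) F &
    (perimeter C F <= perimeter C E + eps%:E + (N%:R * (2 * rho ^+ N.-1))%:E)%E.
Proof.
move=> v0 d0 r0 e0 dr [mE EC vE].
have Eoo : (leb E < +oo)%E by rewrite vE ltry.
have a0 : 0 < `|a| by rewrite normr_gt0.
have [S hS] := lower_half_exhaust mE Eoo d0.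
(* Division by [|a|] cancels the slope factor in [cut_perimeter], leaving a cost of exactly
   [eps]. *)
have [s Ss Ps] := cut_perimeter a i C S mE Eoo (divr_gt0 e0 a0).
set H := lower_half a i s in Ps.
have mH : lebesgue_measurable H by exact: lower_half_measurable.
have mEH : lebesgue_measurable (E `&` H) by exact: (measurableI _ _ mE mH).
have EHoo : (leb (E `&` H) < +oo)%E.
  by apply: le_lt_trans Eoo; apply: le_lebesgue_rV => //; exact: subIsetl.
have [w wE wv] : exists2 w, leb (E `&` H) = w%:E & v - d <= w <= v.
  have h1 := hS s Ss; have : (leb (E `&` H) <= leb E)%E.
    by apply: le_lebesgue_rV => //; exact: subIsetl.
  move: h1; rewrite -/H vE; have : (0 <= leb (E `&` H))%E by exact: measure_ge0.
  case: (leb (E `&` H)) EHoo => // w _ _; rewrite -EFinB !lee_fin => h1 h2.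
  by exists w => //; rewrite h1 h2.
(* The cube makes up the wanted [d] and the loss [v - w], which is at most [d]; so
   [r ^+ N <= d + d], whence [r <= rho]. *)
have [r rp rN] : exists2 r : R, 0 < r & r ^+ N = v + d - w.
  by apply: positive_root => //; lra.
have rrho : r <= rho.
  by rewrite -(@ler_pXn2r _ N) ?nnegrE ?(ltW rp) ?(ltW r0)// rN; lra.
have [l lC] := cube_in_cone (i := i) c0 Cp ui uc s rp.
have mQ : lebesgue_measurable (cube l r) by exact: box_measurable.
have QE : leb (cube l r) = (v + d - w)%:E by rewrite cube_volume ?rN// ltW.
have Qoo : (leb (cube l r) < +oo)%E by rewrite QE ltry.
have dis : [disjoint E `&` H & cube l r].
  by apply/disj_setPS => x [[_ Hx] /lC[_]].
exists ((E `&` H) `|` cube l r).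
  split; first exact: (measurableU _ _ mEH mQ).
    by move=> x [[/EC//]|/lC[]].
  apply: etrans (measureU leb mEH mQ _) _; first by apply/eqP; rewrite -disj_set2E.
  transitivity (w%:E + (v + d - w)%:E)%E; first by congr (_ + _)%E;
    [exact: wE|exact: QE].
  by rewrite -EFinD; congr EFin; ring.
apply: le_trans (perimeterU_le C mEH mQ EHoo Qoo dis) _.
apply: leeD.
  by apply: le_trans Ps _; rewrite mulrCA mulfV ?mulr1// gt_eqF.
apply: le_trans (cube_perimeter C l rp) _.
rewrite lee_fin ler_wpM2l// ler_wpM2l// lerXn2r// ?nnegrE ltW//.
Qed.

Local Notation I := (isoperimetric_profile C).

Lemma profile_ge0 v : (0 <= I v)%E.
Proof. by apply: le_ereal_inf_tmp => _ [E _ <-]; exact: perimeter_ge0. Qed.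

Lemma profile_lty v : 0 < v -> (I v < +oo)%E.
Proof.
move=> v0; have [r r0 rN] := positive_root N0 v0.
have [l lC] := cube_in_cone (i := i) c0 Cp ui uc 0 r0.
apply: (@le_lt_trans _ _ (perimeter C (cube l r))); last first.
  by apply: le_lt_trans (cube_perimeter C l r0) _; rewrite ltry.
apply: ereal_inf_lbound; exists (cube l r) => //; split.
- exact: box_measurable.
- by move=> x /lC[].
- by rewrite cube_volume ?rN// ltW.
Qed.

Lemma profile_nondecreasing v w : 0 < w -> w <= v -> (I w <= I v)%E.
Proof.
move=> w0 wv; apply: le_ereal_inf_tmp => _ [E cE <-].
have [F cF /(le_trans _)] := shrink w0 wv cE; apply.
by apply: ereal_inf_lbound; exists F.
Qed.

Lemma profile_growth (eta : R) : 0 < eta ->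
  exists2 d0, 0 < d0 & forall v d,
    0 < v -> 0 < d -> d <= d0 -> (I (v + d) <= I v + eta%:E)%E.
Proof.
move=> e0; have NR : 0 < N%:R :> R by rewrite ltr0n.
(* With [rho <= 1] and [N.-1] at least 1, the cost [N * 2 * rho ^+ N.-1] is at most [N * 2 * rho],
   hence at most [eta / 2]; cutting takes the other half of [eta]. *)
pose rho := Num.min 1 (eta / 2 / (N%:R * 2)).
have rho0 : 0 < rho by rewrite lt_min ltr01/= !divr_gt0// mulr_gt0.
have rho1 : rho <= 1 by rewrite ge_min lexx.
have rhoN : N%:R * (2 * rho ^+ N.-1) <= eta / 2.
  apply: (@le_trans _ _ (N%:R * 2 * rho)).
    rewrite -mulrA ler_wpM2l ?(ltW NR)// ler_wpM2l//.
    by rewrite -[leRHS]expr1 ler_wiXn2l ?(ltW rho0)// -ltnS prednK.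
  by rewrite mulrC -ler_pdivlMr ?mulr_gt0// ge_min lexx orbT.
exists (rho ^+ N / 2); first by rewrite divr_gt0// exprn_gt0.
move=> v d v0 d0 dle; rewrite -leeBlDr//.
apply: le_ereal_inf_tmp => _ [E cE <-]; rewrite leeBlDr//.
have [||F cF PF] := grow (eps := eta / 2) (rho := rho) v0 d0 rho0 _ _ cE.
- by rewrite divr_gt0.
- lra.
apply: (@le_trans _ _ (perimeter C F)).
  by apply: ereal_inf_lbound; exists F.
apply: le_trans PF _; rewrite -addeA leeD2l// -EFinD lee_fin; lra.
Qed.

Lemma profile_continuous :
  {within [set v : R | 0 < v], continuous (fun v : R => fine (I v))}.
Proof.
have fin v : 0 < v -> I v \is a fin_num.
  by move=> v0; rewrite ge0_fin_numE ?profile_ge0// profile_lty.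
rewrite continuous_open_subspace; last exact: open_gt.
move=> v /set_mem /= v0; apply/cvgrPdist_le => e e0.
have [d0 d00 hd] := profile_growth e0.
(* Growth is applied at the smaller point, whichever side of [v] it is on; this relies on [d0] being
   the same for all volumes. *)
have step x y : 0 < x -> x < y -> y - x <= d0 -> `|fine (I x) - fine (I y)| <= e.
  move=> x0 xy yx.
  have h1 : fine (I x) <= fine (I y).
    apply: fine_le; [exact: fin|apply: fin; exact: lt_trans xy|].
    by apply: profile_nondecreasing => //; exact: ltW.
  have h2 : fine (I y) <= fine (I x) + e.
    rewrite -lee_fin EFinD !fineK ?fin ?(lt_trans x0 xy)//.
    by have := hd x (y - x) x0; rewrite subr_gt0 (addrC x) subrK; apply.
  by rewrite ler_norml; lra.
(* Staying within [v] of [v] keeps [w] positive. *)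
have m0 : 0 < Num.min d0 v by rewrite lt_min d00.
near=> w.
have : `|v - w| < Num.min d0 v.
  by near: w; apply: cvgr_dist_lt.
rewrite lt_min !ltr_norml => /andP[/andP[w1 w2] /andP[w3 w4]].
have [vw|wv|->] := ltgtP v w; last by rewrite subrr normr0 ltW.
- by apply: step => //; lra.
- by rewrite distrC; apply: step; lra.
Unshelve. all: by end_near. Qed.

End profile.

Unset Implicit Arguments.

Theorem lemma3p5 (R : realType) (n : nat) (hn : (1 <= n)%N)
    (C : set 'rV[R]_n.+1) (hC : unbounded_convex_body C)
    (p : 'rV[R]_n.+1) (hp : C p)
    (hdim : affine_dim (asymptotic_cone C p) = n.+1) :
  (forall v : R, 0 < v -> (0 <= isoperimetric_profile C v < +oo)%E) /\
  {within [set v : R | 0 < v],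
    continuous (fun v : R => fine (isoperimetric_profile C v))}.
Proof.
have [clC cC _ _] := hC.
have [u0 [c0 [c00 uc0]]] := recession_ball clC cC (ltn0Sn n) hdim.
have [u [c [ui c1 uc]]] := recession_ball_coord ord0 c00 uc0.
split=> [v v0|]; last exact: (@profile_continuous _ _ C p u c ord0).
by rewrite profile_ge0/= (@profile_lty _ _ C p u c ord0).
Qed.
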